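(* Let $Z$ be a random variable with values in $\{1,2,\dots\}$ and $\mu:=\mathbf{E}[Z]>1$, and let $\mathbf{T}$ be a Galton-Watson tree with progeny distribution $Z$. Let $p_c=1/\mu$, let $Y_n$ be the set of vertices of $\mathbf{T}$ at depth $n$ connected to the root in $p_c$ percolation, and let $\lambda:=\frac{2}{p_c^2\phi''(1)}$, where $\phi(z)=\sum_k \mathbf{P}[Z=k]z^k$. If $\mathbf{E}[Z^4]<\infty$, then $$n\cdot \mathbf{P}_{\mathbf{T}}[|Y_n|>0]\to W\lambda\qquad (n\to\infty)$$ almost surely (i.e. for almost every $\mathbf{T}$).
   Context: The Galton-Watson tree $\mathbf{T}$ is the random rooted tree in which every vertex independently has a number of children distributed as $Z$. With $Z_n$ the number of vertices at depth $n$, $W_n:=Z_n/\mu^n$ and $W:=\lim_n W_n$ (an almost sure limit). Given $\mathbf{T}$, in $p_c$ percolation each edge is independently open with probability $p_c$; $\mathbf{P}_{\mathbf{T}}$ denotes the conditional (quenched) probability given $\mathbf{T}$. Here $\phi''(1)=\mathbf{E}[Z(Z-1)]$. *)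

(* Defs.v *)
From HB Require Import structures.
From mathcomp Require Import all_boot all_order all_algebra.
From mathcomp Require Import all_classical all_reals all_analysis.

Set Implicit Arguments.
Unset Strict Implicit.
Unset Printing Implicit Defensive.

Import Order.TTheory GRing.Theory Num.Theory.
Import numFieldNormedType.Exports.

Local Open Scope classical_set_scope.
Local Open Scope ring_scope.

(** Rooted trees in Ulam-Harris coding: the root is [::], and the children of
    the vertex [v] are [rcons v i] for [i < c v], where [c v] is the number of
    children of [v].  The values of [c] off the tree are irrelevant. *)

Definition in_tree (c : seq nat -> nat) (v : seq nat) : bool :=
  all (fun k => nth 0%N v k < c (take k v))%N (iota 0 (size v)).

Fixpoint generation (c : seq nat -> nat) (n : nat) : seq (seq nat) :=
  if n is m.+1
  then [seq rcons v i | v <- generation c m, i <- iota 0 (c v)]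
  else [:: [::]].

Lemma in_tree_rcons c v i :
  in_tree c (rcons v i) = in_tree c v && (i < c v)%N.
Proof.
rewrite /in_tree size_rcons -[in iota _ _]addn1 iotaD all_cat /= andbT add0n.
rewrite nth_rcons ltnn eqxx -cats1 take_size_cat //; congr (_ && _).
apply: eq_in_all => k; rewrite mem_iota add0n => /andP[_ kv].
by rewrite nth_cat kv takel_cat // ltnW.
Qed.

Lemma mem_generation c n v :
  (v \in generation c n) = (size v == n) && in_tree c v.
Proof.
elim: n v => [|n IHn] v /=; first by rewrite inE; case: v.
case/lastP: v => [|v i].
  by rewrite eq_sym; apply/allpairsPdep => -[w [j [_ _]]]; case: w.
rewrite size_rcons eqSS in_tree_rcons andbA -IHn.
apply/allpairsPdep/andP => [[w [j [wn]]]|[vn ic]].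
  by rewrite mem_iota add0n => /andP[_ jc] /rcons_inj [-> ->].
by exists v, i; rewrite mem_iota add0n ic.
Qed.

Lemma generation_uniq c n : uniq (generation c n).
Proof.
elim: n => //= n IHn; apply: allpairs_uniq_dep => // [v _|]; first exact: iota_uniq.
by move=> [v i] [w j] _ _ /= /rcons_inj [-> ->].
Qed.

(** The edge joining a non-root vertex to its parent is labelled by that vertex;
    [open v] says that this edge is open ([open [::]] is never used).  The
    only path from the root to [v] goes through the prefixes of [v]. *)

Definition connected_to_root (open : seq nat -> bool) (v : seq nat) : bool :=
  all (fun k => open (take k v)) (iota 1 (size v)).

Definition open_cluster_level (c : seq nat -> nat) (open : seq nat -> bool)
    (n : nat) : seq (seq nat) :=
  [seq v <- generation c n | connected_to_root open v].

Definition mutually_independent d d' (T : measurableType d)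
    (T' : measurableType d') (R : realType) (P : probability T R)
    (I : eqType) (X : I -> T -> T') : Prop :=
  forall (s : seq I) (B : I -> set T'), uniq s ->
    (forall i, measurable (B i)) ->
    P (\big[setI/setT]_(i <- s) (X i @^-1` B i)) =
    (\prod_(i <- s) P (X i @^-1` B i))%E.

(** The offspring numbers of all potential vertices are i.i.d. copies of [Z]. *)
Definition galton_watson d0 d (T0 : measurableType d0) (T : measurableType d)
    (R : realType) (P0 : probability T0 R) (Z : {RV P0 >-> nat})
    (P : probability T R) (children : seq nat -> {RV P >-> nat}) : Prop :=
  (forall v (B : set nat),
     distribution P (children v) B = distribution P0 Z B) /\
  mutually_independent P (fun v => children v : T -> nat).

Definition bernoulli_percolation d (T : measurableType d) (R : realType)
    (Q : probability T R) (p : R) (open : seq nat -> {RV Q >-> bool}) : Prop :=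
  (forall v, Q [set w | open v w] = p%:E) /\
  mutually_independent Q (fun v => open v : T -> bool).

(** Quenched probability that generation [n] of the fixed tree [c] is reached. *)
Definition quenched_survival d (T : measurableType d) (R : realType)
    (Q : probability T R) (open : seq nat -> {RV Q >-> bool})
    (c : seq nat -> nat) (n : nat) : R :=
  fine (Q [set w |
    (0 < size (open_cluster_level c (fun v => open v w) n))%N]).

Definition progeny_mean d (T : measurableType d) (R : realType)
    (P : probability T R) (Z : {RV P >-> nat}) : \bar R :=
  ('E_P[fun w => (Z w)%:R%R])%E.

Definition progeny_moment4 d (T : measurableType d) (R : realType)
    (P : probability T R) (Z : {RV P >-> nat}) : \bar R :=
  ('E_P[fun w => ((Z w)%:R ^+ 4)%R])%E.

(** phi''(1) = E[Z(Z-1)] for phi(z) = \sum_k P[Z = k] z^k; this is the one-sided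
    second derivative, the radius of convergence of phi possibly being 1. *)
Definition pgf_deriv2_at1 d (T : measurableType d) (R : realType)
    (P : probability T R) (Z : {RV P >-> nat}) : \bar R :=
  ('E_P[fun w => ((Z w)%:R * ((Z w)%:R - 1))%R])%E.

Definition normalized_size (R : realType) (mu : R) (c : seq nat -> nat)
    (n : nat) : R :=
  (size (generation c n))%:R / mu ^+ n.

(* Main.v *)
(** Write [p = 1/mu], let [q_n(v)] be the quenched probability that the subtree
    of [v] is reached to depth [n], [a_n = E q_n(v)], and [W_n(v)] its normalized
    size.  A root with children [v_i] gives
    [q_{n+1}(v) = 1 - prod_i (1 - p q_n(v_i)) = p sum_i q_n(v_i) - r], where by
    Bonferroni [0 <= r <= p^2 sum_{i<j} q_n(v_i) q_n(v_j)].  As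
    [W_{n+1}(v) = p sum_i W_n(v_i)], the centred difference
    [D_n = q_n - a_n W_n] satisfies
    [D_{n+1}(v) = p sum_i D_n(v_i) + (a_n - a_{n+1}) W_{n+1}(v) - r].
    The [D_n(v_i)] are independent and centred, so the first term has second
    moment [p E D_n^2], a strict contraction; the other two have second moments
    [O(n^-4)], using [E q_n^2 = O(n^-2)] and [E Z^4 < oo].  Hence
    [E D_n^2 = O(n^-4)], the series of [E (n D_n)^2] converges, and
    [n D_n -> 0] almost surely.  Finally [n a_n -> lambda] by Kolmogorov's
    estimate for critical branching processes, and [W_n] converges since its
    increments have geometrically decaying second moments. *)

Require Import Defs.
From HB Require Import structures.
From mathcomp Require Import all_boot all_order all_algebra.
From mathcomp Require Import all_classical all_reals all_analysis.
From mathcomp Require Import measurable_realfun ring lra.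

Set Implicit Arguments.
Unset Strict Implicit.
Unset Printing Implicit Defensive.

Import Order.TTheory GRing.Theory Num.Theory.
Import numFieldNormedType.Exports.

Local Open Scope classical_set_scope.
Local Open Scope ring_scope.

(** * Independence of generated sigma-algebras *)

(** Tree and percolation live on separate probability spaces. On a fixed tree the percolation is
    integrated out exactly, and the quenched probability becomes the deterministic functional
    [surv]; what remains concerns random variables on the space of trees. The obstacle there is that
    siblings are summed up to the random index [children v]. Offspring numbers are attached to every
    Ulam-Harris word, so the quantities of the vertex [rcons v i] exist for all [i] and depend on
    disjoint sets of words. Conditioning on the number of children is then a countable partition
    followed by independence of sigma-algebras. Moment bounds are proved for all [v] at once, by
    induction on [n]. Subtracting a_n W_n is what makes the rate good enough. As E q_n = a_n is of
    order 1/n, E q_n^2 is at least of order n^-2, and multiplied by n^2 this is not summable. The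
    centred D_n avoids this: its own source terms are of order n^-2 in size, hence n^-4 in second
    moment. *)

Section IndependentSystems.
Context d (T : measurableType d) (R : realType) (P : probability T R).

Definition indep_systems (S1 S2 : set (set T)) :=
  forall E F, S1 E -> S2 F -> P (E `&` F) = (P E * P F)%E.

Lemma indep_systemsC S1 S2 : indep_systems S1 S2 -> indep_systems S2 S1.
Proof. by move=> S12 E F SE SF; rewrite setIC muleC S12. Qed.

Lemma sub_sigma_measurable (S : set (set T)) :
  S `<=` measurable -> <<s S >> `<=` measurable.
Proof.
by move=> Sm; apply: smallest_sub => //; exact: sigma_algebra_measurable.
Qed.

(** For a fixed [E], the measurable [F] obeying the product rule form a Dynkin system; as [S2] is
    closed under intersection, the Dynkin system it generates is already the sigma-algebra. *)
Lemma indep_systems_sigmar (S1 S2 : set (set T)) :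
  S1 `<=` measurable -> S2 `<=` measurable -> setI_closed S2 ->
  indep_systems S1 S2 -> indep_systems S1 <<s S2 >>.
Proof.
move=> S1m S2m S2I S12 E F S1E.
have mE := S1m _ S1E; rewrite -setI_closed_g_dynkin_g_sigma_algebra//.
move: F; suff H : <<d S2 >> `<=`
    [set F : set T | measurable F /\ P (E `&` F) = (P E * P F)%E].
  by move=> F /H[].
apply: smallest_sub => [|F S2F]; last by split; [exact: S2m|exact: S12].
split=> [|F [mF EF]|F tF HF].
- by split=> //; rewrite setIT probability_setT mule1.
- split; first exact: measurableC.
  rewrite -setDE measureD//; last by rewrite (le_lt_trans (probability_le1 P mE)) ?ltry.
  rewrite [X in (_ - X)%E]EF probability_setC// muleBr ?mule1//; exact: fin_num_measure.
- have mF n : measurable (F n) by case: (HF n).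
  split; first exact: bigcup_measurable.
  rewrite setI_bigcupr measure_semi_bigcup//; last 3 first.
  + by move=> i; exact: measurableI.
  + exact: trivIset_setIl.
  + by apply: bigcup_measurable => i _; exact: measurableI.
  rewrite measure_semi_bigcup//; last exact: bigcup_measurable.
  have fE : P E \is a fin_num by exact: fin_num_measure.
  rewrite -(fineK fE) -nneseriesZl//.
  by apply: eq_eseriesr => i _; rewrite fineK// -(HF i).2.
Qed.

Lemma indep_systems_sigma (S1 S2 : set (set T)) :
  S1 `<=` measurable -> S2 `<=` measurable ->
  setI_closed S1 -> setI_closed S2 ->
  indep_systems S1 S2 -> indep_systems <<s S1 >> <<s S2 >>.
Proof.
move=> S1m S2m S1I S2I S12; apply: indep_systemsC.
apply: indep_systems_sigmar => //; first exact: sub_sigma_measurable.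
by apply: indep_systemsC; exact: indep_systems_sigmar.
Qed.

End IndependentSystems.

Lemma big_setIP (T : Type) (I : eqType) (s : seq I) (F : I -> set T) w :
  (\big[setI/setT]_(i <- s) F i) w <-> (forall i, i \in s -> F i w).
Proof.
elim: s => [|i s IHs]; first by rewrite big_nil.
rewrite big_cons; split=> [[Fi /IHs Fs] j|Fs].
  by rewrite inE => /orP[/eqP->//|/Fs].
split; first by apply: Fs; rewrite mem_head.
by apply/IHs => j js; apply: Fs; rewrite inE js orbT.
Qed.

Section IndependentFamily.
Context d d' (T : measurableType d) (T' : measurableType d') (R : realType)
  (P : probability T R) (I : eqType) (X : I -> T -> T').

(** Finite cylinders form the intersection-stable class on which [mutually_independent] prescribes
    the probability; independence of blocks of indices is checked there and then extended to
    [fsigma]. *)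
Definition cylinders (A : set I) : set (set T) :=
  [set E | exists s B, [/\ uniq s, forall i, i \in s -> A i,
     forall i, measurable (B i) &
     E = \big[setI/setT]_(i <- s) (X i @^-1` B i)]].

Lemma cylinders1 (A : set I) i (B : set T') :
  A i -> measurable B -> cylinders A (X i @^-1` B).
Proof.
move=> Ai mB; exists [:: i], (fun=> B); split=> //.
- by move=> j; rewrite inE => /eqP->.
- by rewrite big_seq1.
Qed.

Lemma cylinders_setI A : setI_closed (cylinders A).
Proof.
move=> _ _ [s1 [B1 [u1 sA1 mB1 ->]]] [s2 [B2 [u2 sA2 mB2 ->]]].
(* An index absent from one of the lists is unconstrained there, hence the default [setT]. *)
pose C (s : seq I) (B : I -> set T') i := if i \in s then B i else setT.
exists (undup (s1 ++ s2)), (fun i => C s1 B1 i `&` C s2 B2 i); split.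
- exact: undup_uniq.
- by move=> i; rewrite mem_undup mem_cat => /orP[/sA1|/sA2].
- move=> i; apply: measurableI; rewrite /C; case: ifP => //.
- apply/seteqP; split=> w.
  + move=> [/big_setIP H1 /big_setIP H2]; apply/big_setIP => i _.
    by split; rewrite /= /C; case: ifP => // ?; [exact: H1|exact: H2].
  + move=> /big_setIP H; split; apply/big_setIP => i si.
      have [|+ _] := H i; first by rewrite mem_undup mem_cat si.
      by rewrite /C /= si.
    have [|_] := H i; first by rewrite mem_undup mem_cat si orbT.
    by rewrite /C /= si.
Qed.

Hypothesis mX : forall i, measurable_fun setT (X i).
Hypothesis indX : mutually_independent P X.

Lemma cylinders_measurable A : cylinders A `<=` measurable.
Proof.
move=> _ [s [B [_ _ mB ->]]]; apply: big_ind => //; first exact: measurableI.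
by move=> i _; rewrite -[X in measurable X]setTI; exact: mX.
Qed.

(** Disjointness makes the concatenation of the two index lists duplicate-free, so both cylinders
    merge into a single instance of mutual independence. *)
Lemma cylinders_indep A B : A `&` B = set0 ->
  indep_systems P (cylinders A) (cylinders B).
Proof.
move=> AB _ _ [s1 [B1 [u1 sA1 mB1 ->]]] [s2 [B2 [u2 sA2 mB2 ->]]].
pose C i := if i \in s1 then B1 i else B2 i.
have mC i : measurable (C i) by rewrite /C; case: ifP.
have s12 i : i \in s2 -> i \notin s1.
  move=> i2; apply/negP => i1; suff: (A `&` B) i by rewrite AB.
  by split; [exact: sA1|exact: sA2].
have E1 : \big[setI/setT]_(i <- s1) (X i @^-1` B1 i) =
          \big[setI/setT]_(i <- s1) (X i @^-1` C i).
  by apply: eq_big_seq => i i1; rewrite /C i1.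
have E2 : \big[setI/setT]_(i <- s2) (X i @^-1` B2 i) =
          \big[setI/setT]_(i <- s2) (X i @^-1` C i).
  by apply: eq_big_seq => i /s12 /negbTE i1; rewrite /C i1.
rewrite E1 E2 -big_cat/= !indX// ?big_cat//.
by rewrite cat_uniq u1 u2 andbT; apply/hasPn => i /s12.
Qed.

Definition fsigma A := <<s cylinders A >>.

Lemma fsigma_measurable A : fsigma A `<=` measurable.
Proof. exact/sub_sigma_measurable/cylinders_measurable. Qed.

Lemma fsigma_indep A B : A `&` B = set0 -> indep_systems P (fsigma A) (fsigma B).
Proof.
move=> AB; apply: indep_systems_sigma; try exact: cylinders_measurable;
  try exact: cylinders_setI; exact: cylinders_indep.
Qed.

Lemma sub_fsigma A B : A `<=` B -> fsigma A `<=` fsigma B.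
Proof.
move=> AB; apply: sub_smallest2r; first exact: smallest_sigma_algebra.
by move=> E [s [C [us sA mC ->]]]; exists s, C; split=> // i /sA/AB.
Qed.

Lemma fsigma1 (A : set I) i (B : set T') :
  A i -> measurable B -> fsigma A (X i @^-1` B).
Proof. by move=> Ai mB; apply: sub_gen_smallest; exact: cylinders1. Qed.

End IndependentFamily.

(** * Expectations of products of independent variables, by Fubini on the joint law *)

Section IndependentProduct.
Context d (T : measurableType d) (R : realType) (P : probability T R).
Local Open Scope ereal_scope.

Definition indep_rv (f g : T -> R) := forall A B : set R,
  measurable A -> measurable B ->
  P (f @^-1` A `&` g @^-1` B) = P (f @^-1` A) * P (g @^-1` B).

Definition pair_rv (f g : T -> R) w := (f w, g w).

Context (f g : {RV P >-> R}) (fg : indep_rv f g).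

Let mfg : measurable_fun setT (pair_rv f g).
Proof. exact: measurable_fun_pair. Qed.

HB.instance Definition _ := isMeasurableFun.Build _ _ _ _ _ mfg.

Lemma joint_law (X : set (R * R)) : measurable X ->
  (distribution P f \x distribution P g) X = distribution P (pair_rv f g) X.
Proof. by apply: product_measure_unique; exact: fg. Qed.

Lemma ge0_integral_indep (h : R * R -> \bar R) :
  measurable_fun [set: R * R] h -> (forall x, 0 <= h x) ->
  \int[P]_w h (f w, g w) =
  \int[distribution P f]_x \int[distribution P g]_y h (x, y).
Proof.
move=> mh h0; rewrite -(fubini_tonelli1 (m1 := distribution P f) (m2 := distribution P g) h)//.
rewrite (eq_measure_integral (distribution P (pair_rv f g))) => [|A mA _].
  by rewrite ge0_integral_distribution.
exact: joint_law.
Qed.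

Let mmul : measurable_fun setT (fun x : R * R => (x.1 * x.2)%:E).
Proof. by apply/measurable_EFinP; apply: measurable_funM. Qed.

Let mabsmul : measurable_fun [set: R * R] (fun x => `|(x.1 * x.2)%:E|).
Proof. by apply: measurableT_comp mmul; exact: abse_measurable. Qed.

Lemma integral_abs_indep :
  \int[P]_w `|f w * g w|%:E = (\int[P]_w `|f w|%:E) * \int[P]_w `|g w|%:E.
Proof.
rewrite (ge0_integral_indep (h := fun x => `|x.1 * x.2|%:E))//.
under eq_integral do under eq_integral do rewrite /= normrM EFinM.
have mn : measurable_fun [set: R] (fun x : R => `|x|%:E).
  exact/measurable_EFinP.
under eq_integral do rewrite ge0_integralZl//.
rewrite ge0_integralZr//; last exact: integral_ge0.
by rewrite !ge0_integral_distribution.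
Qed.

Lemma integrable_indepM :
  P.-integrable setT (EFin \o f) -> P.-integrable setT (EFin \o g) ->
  P.-integrable setT (fun w => (f w * g w)%:E).
Proof.
move=> /integrableP[_ fi] /integrableP[_ gi]; apply/integrableP; split.
  by apply/measurable_EFinP; exact: measurable_funM.
rewrite integral_abs_indep lte_mul_pinfty//; first exact: integral_ge0.
by rewrite ge0_fin_numE//; exact: integral_ge0.
Qed.

Lemma integral_indepM :
  P.-integrable setT (EFin \o f) -> P.-integrable setT (EFin \o g) ->
  \int[P]_w (f w * g w)%:E = (\int[P]_w (f w)%:E) * \int[P]_w (g w)%:E.
Proof.
move=> fi gi.
have df : \int[distribution P f]_x x%:E = \int[P]_w (f w)%:E.
  by rewrite integral_distribution//; exact/measurable_EFinP.
have dg : \int[distribution P g]_x x%:E = \int[P]_w (g w)%:E.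
  by rewrite integral_distribution//; exact/measurable_EFinP.
have mE : measurable_fun [set: R] (@EFin R) by exact/measurable_EFinP.
have dfi : (distribution P f).-integrable setT (@EFin R).
  by apply: integrable_pushforward.
have dgi : (distribution P g).-integrable setT (@EFin R).
  by apply: integrable_pushforward.
have -> : \int[P]_w (f w * g w)%:E =
    \int[distribution P (pair_rv f g)]_x (x.1 * x.2)%:E.
  by rewrite integral_distribution//; exact: integrable_indepM.
rewrite (eq_measure_integral (distribution P f \x distribution P g))
  => [|A mA _]; last exact/esym/joint_law.
have := @integral12_prod_meas1 _ _ _ _ R (distribution P f)
    (distribution P g) (fun x => (x.1 * x.2)%:E).
rewrite /fubini_F => <-; last first.
  apply/(@integrable12ltyP _ _ _ _ R (distribution P f) (distribution P g)) => //.
  rewrite -(ge0_integral_indep (h := fun x => `|(x.1 * x.2)%:E|))//.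
    by have /integrableP[] := integrable_indepM fi gi.
under eq_integral do under eq_integral do rewrite /= EFinM.
under eq_integral do rewrite integralZl// dg.
have g_fin : \int[P]_w (g w)%:E \is a fin_num by exact: integrable_fin_num.
by rewrite -(fineK g_fin) integralZr// df.
Qed.

End IndependentProduct.

Section FamilyMeasurable.
Context d d' (T : measurableType d) (T' : measurableType d') (R : realType)
  (P : probability T R) (I : eqType) (X : I -> T -> T').

(** Dependence on the [X i] with [i] in [A] only, phrased as measurability on a type carrying the
    generated sigma-algebra, so that the closure lemmas for sums and products apply directly. *)
Definition fmeas (A : set I) (f : T -> R) :=
  measurable_fun [set: g_sigma_algebraType (cylinders X A)]
    (f : g_sigma_algebraType (cylinders X A) -> R).

Lemma fmeas_preimage A f (Y : set R) :
  fmeas A f -> measurable Y -> fsigma X A (f @^-1` Y).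
Proof. by move=> mf mY; have := mf measurableT _ mY; rewrite setTI. Qed.

Lemma sub_fmeas A B f : A `<=` B -> fmeas A f -> fmeas B f.
Proof.
move=> AB mf _ Y mY; rewrite setTI.
have := sub_fsigma AB; apply; exact: fmeas_preimage mf mY.
Qed.

Hypothesis mX : forall i, measurable_fun setT (X i).

Lemma fmeas_measurable A f : fmeas A f -> measurable_fun setT f.
Proof.
move=> mf _ Y mY; rewrite setTI; apply: fsigma_measurable => //.
exact: fmeas_preimage mf mY.
Qed.

Lemma fmeas_comp (A : set I) i (h : T' -> R) :
  A i -> measurable_fun setT h -> fmeas A (h \o X i).
Proof.
move=> Ai mh _ Y mY; rewrite setTI comp_preimage.
by apply: fsigma1 => //; rewrite -[X in measurable X]setTI; exact: mh.
Qed.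

Hypothesis indX : mutually_independent P X.
Local Open Scope ereal_scope.

Lemma fmeas_indep A B f g : A `&` B = set0 -> fmeas A f -> fmeas B g ->
  indep_rv P f g.
Proof.
move=> AB mf mg Y Z mY mZ.
by apply: (fsigma_indep mX indX AB); exact: fmeas_preimage.
Qed.

Section Products.
Context (A B : set I) (f g : T -> R).
Hypotheses (AB : A `&` B = set0) (mf : fmeas A f) (mg : fmeas B g).

Let f' : {RV P >-> R} := HB.pack f
  (isMeasurableFun.Build _ _ _ _ _ (fmeas_measurable mf)).
Let g' : {RV P >-> R} := HB.pack g
  (isMeasurableFun.Build _ _ _ _ _ (fmeas_measurable mg)).
Let fg : indep_rv P f' g' := fmeas_indep AB mf mg.

Lemma fmeas_ge0_integralM :
  (forall w, (0 <= f w)%R) -> (forall w, (0 <= g w)%R) ->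
  \int[P]_w (f w * g w)%:E = (\int[P]_w (f w)%:E) * \int[P]_w (g w)%:E.
Proof.
move=> f0 g0; have := integral_abs_indep fg.
under eq_integral do rewrite /= ger0_norm ?mulr_ge0//.
under [X in _ = X * _]eq_integral do rewrite /= ger0_norm//.
by under [X in _ = _ * X]eq_integral do rewrite /= ger0_norm//.
Qed.

Lemma fmeas_integrableM :
  P.-integrable setT (EFin \o f) -> P.-integrable setT (EFin \o g) ->
  P.-integrable setT (fun w => (f w * g w)%:E).
Proof. exact: (integrable_indepM fg). Qed.

Lemma fmeas_integralM :
  P.-integrable setT (EFin \o f) -> P.-integrable setT (EFin \o g) ->
  \int[P]_w (f w * g w)%:E = (\int[P]_w (f w)%:E) * \int[P]_w (g w)%:E.
Proof. exact: (integral_indepM fg). Qed.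

End Products.

End FamilyMeasurable.

(** * Percolation on a fixed tree *)

(** [generation] grows at the leaves, whereas [surv], [gsize] and [reach] peel off the root [v] of a
    subtree: this is the direction of the branching recursion. *)
Fixpoint surv (R : nzRingType) (p : R) (c : seq nat -> nat) n v : R :=
  if n is m.+1 then 1 - \prod_(i < c v) (1 - p * surv p c m (rcons v i)) else 1.

Fixpoint gsize (c : seq nat -> nat) n v : nat :=
  if n is m.+1 then (\sum_(i < c v) gsize c m (rcons v i))%N else 1%N.

Fixpoint reach (c : seq nat -> nat) (o : seq nat -> bool) n v : bool :=
  if n is m.+1
  then has (fun i => o (rcons v i) && reach c o m (rcons v i)) (iota 0 (c v))
  else true.

Lemma size_generation c n : size (generation c n) = gsize c n [::].
Proof.
(* Interpolates between the two recursions: [n] levels are listed from the root and [m] more are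
   counted below, and each induction step transfers one level. *)
have H m : (\sum_(v <- generation c n) gsize c m v)%N = gsize c (n + m) [::].
  elim: n m => [|n IHn] m; first by rewrite [generation _ _]/= big_seq1.
  rewrite addSnnS -IHn [generation _ _]/= big_allpairs_dep.
  apply: eq_bigr => v _ /=.
  by rewrite -(big_mkord xpredT (fun i => gsize c m (rcons v i))) /index_iota subn0.
by rewrite -[in RHS](addn0 n) -H -sum1_size.
Qed.

Lemma connected_to_root_rcons o v i :
  connected_to_root o (rcons v i) = connected_to_root o v && o (rcons v i).
Proof.
rewrite /connected_to_root size_rcons -[(size v).+1]addn1 iotaD all_cat/= andbT.
congr (_ && _); last by rewrite add1n -(size_rcons v i) take_size.
apply: eq_in_all => k; rewrite mem_iota => /andP[_ kv].
by rewrite -cats1 takel_cat.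
Qed.

Lemma reach_root c o n :
  (0 < size (open_cluster_level c o n))%N = reach c o n [::].
Proof.
rewrite -[in RHS](addn0 n) /open_cluster_level size_filter -has_count.
(* The same interpolation: [connected_to_root] reads the upper [n] levels and [reach] the lower
   [m]. *)
have H m : has (fun v => connected_to_root o v && reach c o m v) (generation c n) =
    reach c o (n + m) [::].
  elim: n m => [|n IHn] m; first by rewrite /= orbF.
  rewrite addSnnS -IHn; apply/hasP/hasP => /=.
    move=> [_ /allpairsPdep[v [i [vn ic ->]]]].
    rewrite connected_to_root_rcons -andbA => /and3P[cv ov rv]; exists v => //.
    by rewrite cv; apply/hasP; exists i => //; rewrite ov.
  move=> [v vn /andP[cv /hasP[i ic /andP[ov rv]]]]; exists (rcons v i).
    by apply/allpairsPdep; exists v, i.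
  by rewrite connected_to_root_rcons cv ov.
by rewrite -H; apply: eq_has => v; rewrite andbT.
Qed.

Lemma surv_itv (R : realDomainType) (p : R) c n v :
  0 <= p <= 1 -> 0 <= surv p c n v <= 1.
Proof.
move=> /andP[p0 p1]; elim: n v => [|n IHn] v /=; first by rewrite ler01 lexx.
have H (i : 'I_(c v)) : 0 <= 1 - p * surv p c n (rcons v i) <= 1.
  have /andP[s0 s1] := IHn (rcons v i); rewrite subr_ge0 lerBlDr lerDl.
  by rewrite mulr_ile1// mulr_ge0.
rewrite subr_ge0 lerBlDr lerDl prodr_ge0 ?andbT; last by move=> i _; case/andP: (H i).
by apply: prodr_ile1 => i _.
Qed.

Definition subtree (v : seq nat) : set (seq nat) := [set u | prefix v u].
Definition below (v : seq nat) : set (seq nat) := [set u | prefix v u && (u != v)].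
(** The words below the first [k] children. They are disjoint from the subtree of child [k], so sums
    and products over siblings can be treated by adding one independent child at a time. *)
Definition branches (v : seq nat) k : set (seq nat) :=
  [set u | exists2 i, (i < k)%N & subtree (rcons v i) u].

Lemma subtree_rcons v i : subtree (rcons v i) `<=` below v.
Proof.
move=> u /prefixP[s ->]; rewrite /below/= cat_rcons prefix_prefix/=.
by rewrite -[X in _ != X]cats0 eqseq_cat// eqxx.
Qed.

Lemma below_subtree v : below v `<=` subtree v.
Proof. by move=> u /andP[]. Qed.

Lemma subtree_disj v i j : i <> j ->
  subtree (rcons v i) `&` subtree (rcons v j) = set0.
Proof.
move=> ij; apply/seteqP; split=> // u [/prefixP[s ->] /prefixP[t]] /=.
by rewrite !cat_rcons => /eqP; rewrite eqseq_cat// eqxx/= => /eqP[].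
Qed.

Lemma branches_disj v k : branches v k `&` subtree (rcons v k) = set0.
Proof.
apply/seteqP; split=> // u [[i ik ui] uk].
have ik' : i <> k by move=> E; rewrite E ltnn in ik.
by have : (subtree (rcons v i) `&` subtree (rcons v k)) u by []; rewrite subtree_disj.
Qed.

Lemma branches_below v k : branches v k `<=` below v.
Proof. by move=> u [i _]; exact: subtree_rcons. Qed.

Lemma sub_branches v k : branches v k `<=` branches v k.+1.
Proof. by move=> u [i ik]; exists i => //; exact: ltnW. Qed.

Lemma subtree_branches v i k : (i < k)%N -> subtree (rcons v i) `<=` branches v k.
Proof. by move=> ik u; exists i. Qed.

Lemma root_disj v : [set v] `&` below v = set0.
Proof. by apply/seteqP; split=> // u [->]; rewrite /below/= eqxx andbF. Qed.

Section QuenchedSurvival.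
Context d (T : measurableType d) (R : realType) (Q : probability T R)
  (open : seq nat -> {RV Q >-> bool}) (p : R).
Hypothesis perc : bernoulli_percolation p open.
Let o w v := open v w.
Let ind := perc.2.
Let mo v : measurable_fun setT (open v : T -> bool).
Proof. exact: measurable_funP. Qed.
Let sigma := fsigma (fun v => open v : T -> bool).

(** The measurability claim travels with the induction because it supplies the independence.
    Reaching depth from [v] ignores the edge above [v], which is labelled [v]; hence [below v], a
    set disjoint from that label. *)
Lemma reach_quenched c n v :
  sigma (below v) [set w | reach c (o w) n v] /\
  Q [set w | reach c (o w) n v] = (surv p c n v)%:E.
Proof.
elim: n v => [|n IHn] v.
  split; last by rewrite -(probability_setT Q); congr (Q _); apply/seteqP.
  rewrite [X in sigma _ X](_ : _ = setT); last by apply/seteqP.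
  exact: (@measurableT _ (g_sigma_algebraType _)).
pose A i := [set w | open (rcons v i) w && reach c (o w) n (rcons v i)].
have AE i : A i = open (rcons v i) @^-1` [set true] `&`
    [set w | reach c (o w) n (rcons v i)].
  by rewrite /A; apply/seteqP; split=> w /=; [move/andP|move=> [-> ->]].
have sA i : sigma (subtree (rcons v i)) (A i).
  rewrite AE; apply: (@measurableI _ (g_sigma_algebraType _)).
    by apply: fsigma1 => //; rewrite /subtree/= prefix_refl.
  exact: (sub_fsigma (@below_subtree _)) (IHn _).1.
have QA i : Q (A i) = (p * surv p c n (rcons v i))%:E.
  rewrite AE (fsigma_indep mo ind (root_disj (rcons v i))).
  - rewrite (IHn _).2 EFinM -(perc.1 (rcons v i)); congr (Q _ * _)%E.
  - exact: fsigma1.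
  - exact: (IHn _).1.
(* None of the first [k] children is both joined to [v] and the start of a surviving path; the
   recursion of [surv] is the complement of this event at [k = c v]. *)
pose N k := \big[setI/setT]_(i < k) ~` A i.
have sN k : sigma (branches v k) (N k).
  rewrite /N; elim: k => [|k IHk].
    by rewrite big_ord0; exact: (@measurableT _ (g_sigma_algebraType _)).
  rewrite big_ord_recr /=; apply: (@measurableI _ (g_sigma_algebraType _)).
    exact: (sub_fsigma (@sub_branches _ _)) IHk.
  apply: (@measurableC _ (g_sigma_algebraType _)).
  exact: (sub_fsigma (@subtree_branches _ _ _ (ltnSn k))) (sA k).
have mA i : measurable (A i) by exact: fsigma_measurable (sA i).
have QN k : Q (N k) = (\prod_(i < k) (1 - p * surv p c n (rcons v i)))%:E.
  elim: k => [|k IHk]; first by rewrite /N !big_ord0 probability_setT.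
  rewrite big_ord_recr /N big_ord_recr/=.
  rewrite (fsigma_indep mo ind (branches_disj v k)).
  - by rewrite IHk EFinM probability_setC// QA.
  - exact: sN.
  - by apply: (@measurableC _ (g_sigma_algebraType _)); exact: sA.
have E : [set w | reach c (o w) n.+1 v] = ~` N (c v).
  rewrite /N -[RHS]setCK setCK; apply/seteqP; split=> w /=.
    move=> /hasP[i]; rewrite mem_iota add0n => /andP[_ ic] Aw.
    by rewrite -(bigcap_mkord _ (fun i => ~` A i)) => /(_ i ic).
  apply: contra_notT => /hasPn H; rewrite -(bigcap_mkord _ (fun i => ~` A i)) => i /= ic.
  by apply/negP/H; rewrite mem_iota.
have mN : measurable (N (c v)) by exact: fsigma_measurable (sN _).
split; last by rewrite E probability_setC// QN.
rewrite E; apply: (@measurableC _ (g_sigma_algebraType _)).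
exact: (sub_fsigma (@branches_below _ _)) (sN _).
Qed.

Lemma quenched_survivalE c n : quenched_survival open c n = surv p c n [::].
Proof.
rewrite /quenched_survival.
under eq_set do rewrite reach_root.
by have := (reach_quenched c n [::]).2; rewrite /o => ->.
Qed.

End QuenchedSurvival.

(** * Elementary inequalities and recursive sequences *)

Section ProductBounds.
Context (R : realFieldType).
Implicit Types (x : nat -> R) (y : R).

(** The second elementary symmetric polynomial, grouped by the larger index to suit inductions that
    add the last sibling. *)
Definition pair_sum x k := \sum_(j < k) x j * \sum_(i < j) x i.

Lemma pair_sumS x k : pair_sum x k.+1 = pair_sum x k + x k * \sum_(i < k) x i.
Proof. by rewrite /pair_sum big_ord_recr. Qed.

(** Bernoulli's inequality for the exponent k - 1, multiplied by 1 - y. Free of a cubic error, it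
    gives a strict decrease of the survival probability already for small [n], where the Taylor
    bound is too weak. *)
Lemma one_sub_exp_le k y : (0 < k)%N -> 0 <= y <= 1 ->
  1 - (1 - y) ^+ k <= k%:R * y - (k%:R - 1) * y ^+ 2.
Proof.
move=> + /andP[y0 y1]; case: k => // k _.
have H : 1 - k%:R * y <= (1 - y) ^+ k.
  elim: k => [|k IHk]; first by rewrite mul0r subr0 expr0.
  rewrite [(1 - y) ^+ _.+1]exprS -(natr1 k).
  have : (1 - y) * (1 - k%:R * y) <= (1 - y) * (1 - y) ^+ k.
    by rewrite ler_wpM2l// subr_ge0.
  have : 0 <= k%:R * y ^+ 2 by rewrite mulr_ge0// exprn_ge0.
  by lra.
rewrite [(1 - y) ^+ _.+1]exprS -(natr1 k).
have : (1 - y) * (1 - k%:R * y) <= (1 - y) * (1 - y) ^+ k.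
  by rewrite ler_wpM2l// subr_ge0.
by lra.
Qed.

(** Both bounds are carried through one induction: multiplying by 1 - y produces the stray term
    k(k-1)/2 y^3, which the growth of k^3 absorbs. *)
Lemma one_sub_exp_taylor k y : 0 <= y <= 1 ->
  `|1 - (1 - y) ^+ k - k%:R * y + k%:R * (k%:R - 1) / 2 * y ^+ 2| <=
    k%:R ^+ 3 * y ^+ 3.
Proof.
move=> /andP[y0 y1].
have y3 : 0 <= y ^+ 3 by rewrite exprn_ge0.
have y4 : 0 <= y ^+ 4 by rewrite exprn_ge0.
have z0 : 0 <= 1 - y by rewrite subr_ge0.
have H : (1 - y) ^+ k <= 1 - k%:R * y + k%:R * (k%:R - 1) / 2 * y ^+ 2 /\
    1 - k%:R * y + k%:R * (k%:R - 1) / 2 * y ^+ 2 - k%:R ^+ 3 * y ^+ 3 <= (1 - y) ^+ k.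
  elim: k => [|k [U L]]; first by rewrite !mul0r expr0; split; lra.
  have kk : 0 <= k%:R * (k%:R - 1) / 2 :> R.
    case: k {U L} => [|k]; first by rewrite !mul0r.
    by rewrite -(natr1 k) addrK divr_ge0// mulr_ge0.
  have := ler_wpM2l z0 U; have := ler_wpM2l z0 L.
  rewrite [(1 - y) ^+ _.+1]exprS -(natr1 k).
  have k1 : 0 <= k%:R :> R by [].
  have k2 : 0 <= k%:R ^+ 2 :> R by rewrite exprn_ge0.
  have k3 : 0 <= k%:R ^+ 3 :> R by rewrite exprn_ge0.
  have := mulr_ge0 k1 y3; have := mulr_ge0 k2 y3; have := mulr_ge0 k3 y4.
  have := mulr_ge0 kk y3.
  set z := (1 - y) ^+ k.
  by split; lra.
by have [] := H; rewrite ler_norml => U L; apply/andP; split; lra.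
Qed.

Lemma one_sub_prod_bounds x k : (forall i, 0 <= x i <= 1) ->
  \sum_(i < k) x i - pair_sum x k <= 1 - \prod_(i < k) (1 - x i)
    <= \sum_(i < k) x i.
Proof.
move=> x01; have prod_ge0 n : 0 <= \prod_(i < n) (1 - x i) <= 1.
  have xi (i : 'I_n) : 0 <= 1 - x i <= 1.
    by have /andP[? ?] := x01 i; apply/andP; split; lra.
  rewrite prodr_ge0 => [|i _]; last by case/andP: (xi i).
  by apply: prodr_ile1 => i _.
elim: k => [|k]; first by rewrite /pair_sum !big_ord0; apply/andP; split; lra.
rewrite pair_sumS !big_ord_recr/= => /andP[L U].
have /andP[p0 p1] := prod_ge0 k; have /andP[x0 x1] := x01 k.
set p := \prod_(i < k) (1 - x i) in L U p0 p1 *.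
set s := \sum_(i < k) x i in L U *.
(* The union bound 1 - p <= s of the previous stage controls the new Bonferroni error x_k (1 -
   p). *)
have : x k * (1 - p) <= x k * s by rewrite ler_wpM2l.
have : x k * p <= x k by rewrite ler_piMr.
by move=> ? ?; apply/andP; split; lra.
Qed.

Lemma pair_sum_ge0 x k : (forall i, 0 <= x i) -> 0 <= pair_sum x k.
Proof.
by move=> x0; apply: sumr_ge0 => j _; rewrite mulr_ge0// sumr_ge0.
Qed.

Lemma sqr_sum_le x k : (\sum_(i < k) x i) ^+ 2 <= k%:R * \sum_(i < k) x i ^+ 2.
Proof.
elim: k => [|k IHk]; first by rewrite !big_ord0 expr0n mul0r.
rewrite !big_ord_recr/= -(natr1 k).
set s := \sum_(i < k) x i in IHk *; set t := \sum_(i < k) x i ^+ 2 in IHk *.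
suff : 2 * (s * x k) <= t + k%:R * x k ^+ 2 by lra.
case: k => [|k] in s t IHk *.
  by rewrite /s /t !big_ord0 !mul0r mulr0 addr0.
have k0 : 0 < k.+1%:R :> R by rewrite ltr0n.
rewrite -(ler_pM2l k0).
have := sqr_ge0 (s - k.+1%:R * x k.+1).
by rewrite sqrrB; lra.
Qed.

(** Two-term Cauchy-Schwarz without square roots: the cross term is compared after squaring, through
    4 (sa)(tb) <= (sb + ta)^2. *)
Lemma sqrD_le_weighted (a b s t A B : R) : 0 <= a -> 0 <= b -> 0 <= s -> 0 <= t ->
  A ^+ 2 <= s * a -> B ^+ 2 <= t * b -> (A + B) ^+ 2 <= (s + t) * (a + b).
Proof.
move=> a0 b0 s0 t0 Aa Bb.
suff : 2 * (A * B) <= s * b + t * a by rewrite sqrrD; lra.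
apply: (le_trans (ler_norm _)); rewrite -(@ler_pXn2r _ 2)// ?nnegrE//.
  rewrite real_normK ?num_real// !exprMn.
  have : A ^+ 2 * B ^+ 2 <= (s * a) * (t * b).
    by rewrite ler_pM// exprn_even_ge0.
  have := sqr_ge0 (s * b - t * a).
  by rewrite sqrrB; lra.
by rewrite addr_ge0// mulr_ge0.
Qed.

(** Cauchy-Schwarz over the pairs, of which there are at most k^2. Squaring each factor inside the
    pairs keeps the two siblings separate, so that independence later factors their second
    moments. *)
Lemma sqr_pair_sum_le x k : (forall i, 0 <= x i) ->
  pair_sum x k ^+ 2 <= k%:R ^+ 2 * pair_sum (fun i => x i ^+ 2) k.
Proof.
move=> x0; elim: k => [|k IHk]; first by rewrite /pair_sum !big_ord0 expr0n mul0r.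
have x20 i : 0 <= x i ^+ 2 by rewrite exprn_ge0.
rewrite !pair_sumS.
have P0 := @pair_sum_ge0 (fun i => x i ^+ 2) k x20.
have T0 : 0 <= x k ^+ 2 * \sum_(i < k) x i ^+ 2 by rewrite mulr_ge0// sumr_ge0.
have k0 : 0 <= k%:R :> R by [].
apply: le_trans (_ : (k%:R ^+ 2 + k%:R) * (pair_sum (fun i => x i ^+ 2) k +
    x k ^+ 2 * \sum_(i < k) x i ^+ 2) <= _).
  apply: sqrD_le_weighted => //.
  by rewrite exprMn [leRHS]mulrCA; apply: ler_wpM2l => //; exact: sqr_sum_le.
by rewrite ler_wpM2r ?addr_ge0// -(natr1 k) sqrrD; lra.
Qed.

End ProductBounds.

Section RecursiveSequences.
Context (R : realType).
Implicit Types u : nat -> R.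

Lemma cvg_inv_shift : (fun n : nat => 1 + n.+1%:R^-1 : R) @ \oo --> (1 : R).
Proof.
rewrite -[X in _ --> X]addr0; apply: cvgD; first exact: cvg_cst.
exact: cvg_harmonic.
Qed.

(** The rescaled sequence u_n (n+1)^m obeys a recursion with factor r ((n+2)/(n+1))^m, which tends
    to r and is eventually below some s < 1. The case [m = 0] gives plain boundedness. *)
Lemma contraction_decay u (r A : R) m : (forall n, 0 <= u n) ->
  0 <= r < 1 -> 0 <= A ->
  (forall n, u n.+1 <= r * u n + A / n.+1%:R ^+ m) ->
  exists2 C, 0 <= C & forall n, u n <= C / n.+1%:R ^+ m.
Proof.
move=> u0 /andP[r0 r1] A0 uS.
pose g n : R := (1 + n.+1%:R^-1) ^+ m.
have g_cvg : r * g n @[n --> \oo] --> r * 1 ^+ m.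
  by apply: cvgMl_tmp; 
  exact: (cvg_comp _ (fun z : R => z ^+ m) cvg_inv_shift (@exprn_continuous R m 1)).
pose s := (1 + r) / 2.
have s1 : s < 1 by rewrite /s; lra.
have rs : r * 1 ^+ m < s by rewrite expr1n mulr1 /s; lra.
have [N _ HN] : \forall n \near \oo, r * g n <= s.
  by apply: (cvgr_le (r * 1 ^+ m)).
have g2 n : g n <= 2 ^+ m.
  rewrite lerXn2r ?nnegrE ?addr_ge0//.
  by rewrite -[leRHS]/(1 + 1) lerD2l invf_le1// ler1n.
have g0 n : 0 <= g n by rewrite exprn_ge0// addr_ge0.
have gE n : n.+2%:R ^+ m = n.+1%:R ^+ m * g n.
  rewrite -exprMn; congr (_ ^+ _).
  by rewrite mulrDr mulr1 divff ?pnatr_eq0// natr1.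
pose y n := u n * n.+1%:R ^+ m.
have y0 n : 0 <= y n by rewrite mulr_ge0// exprn_ge0.
have n0 n : 0 < n.+1%:R ^+ m :> R by rewrite exprn_gt0.
have yS n : y n.+1 <= r * g n * y n + A * 2 ^+ m.
  rewrite /y gE.
  apply: (@le_trans _ _ ((r * u n + A / n.+1%:R ^+ m) * (n.+1%:R ^+ m * g n))).
    by rewrite ler_wpM2r ?uS// mulr_ge0// ltW.
  rewrite mulrDl; apply: lerD; first by rewrite le_eqVlt; apply/orP; left; apply/eqP; ring.
  by rewrite mulrA divfK ?gt_eqF// ler_wpM2l.
pose S := \sum_(i < N.+1) y i.
have S0 : 0 <= S by apply: sumr_ge0.
(* [S] covers the initial terms, before the factor drops below [s]; the other summand is the fixed
   point of y -> s y + A 2^m. *)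
pose C := S + A * 2 ^+ m / (1 - s).
have A2 : 0 <= A * 2 ^+ m by rewrite mulr_ge0// exprn_ge0.
have AC : A * 2 ^+ m <= (1 - s) * C.
  rewrite /C mulrDr [(1 - s) * (_ / _)]mulrC divfK; last by rewrite gt_eqF// subr_gt0.
  by rewrite lerDr mulr_ge0// subr_ge0 ltW.
have SC : S <= C by rewrite /C lerDl divr_ge0// subr_ge0 ltW.
have C0 : 0 <= C by exact: le_trans SC.
have yN n : (n <= N)%N -> y n <= C.
  move=> nN; apply: le_trans SC; have nN' : (n < N.+1)%N by [].
  by rewrite /S (bigD1 (Ordinal nN'))//= lerDl sumr_ge0.
exists C => // n; rewrite ler_pdivlMr//; rewrite -/(y n).
elim: n => [|n IHn]; first exact: yN.
have [nN|nN] := leqP n.+1 N; first exact: yN.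
apply: (le_trans (yS n)).
have : r * g n * y n <= s * C by apply: ler_pM => //; [exact: mulr_ge0|exact: HN].
by move: AC; lra.
Qed.

(** * Kolmogorov's asymptotics for a critical recursion *)

Section CriticalSurvival.
Context (x : nat -> R) (a b c : R).
Hypotheses (a0 : 0 < a) (b0 : 0 <= b) (c0 : 0 < c).
Hypothesis x0 : x 0%N = 1.
Hypothesis x_gt0 : forall n, 0 < x n.
Hypothesis x_decr : forall n, x n.+1 <= x n - c * x n ^+ 2.
Hypothesis x_taylor : forall n, `|x n - x n.+1 - a * x n ^+ 2| <= b * x n ^+ 3.

(** The inverse grows by at least [c] at each step, because (1/x + c)(x - c x^2) = 1 - (c x)^2 <=
    1. *)
Lemma inv_growth n : 1 + c * n%:R <= (x n)^-1.
Proof.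
elim: n => [|n IHn]; first by rewrite mulr0 addr0 x0 invr1.
rewrite -natr1; have xn := x_gt0 n; have xn1 := x_gt0 n.+1.
suff : (x n)^-1 + c <= (x n.+1)^-1 by move: IHn; lra.
rewrite -(ler_pM2r xn1) mulVf ?gt_eqF//.
apply: (@le_trans _ _ (((x n)^-1 + c) * (x n - c * x n ^+ 2))).
  by rewrite ler_wpM2l// addr_ge0// ltW// invr_gt0.
have -> : ((x n)^-1 + c) * (x n - c * x n ^+ 2) = 1 - (c * x n) ^+ 2.
  by field; rewrite gt_eqF.
by rewrite lerBlDr lerDl sqr_ge0.
Qed.

Lemma critical_upper : exists2 C, 0 <= C & forall n, x n <= C / n.+1%:R.
Proof.
exists (1 + c^-1) => [|n]; first by rewrite addr_ge0// invr_ge0 ltW.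
have xn := x_gt0 n; have n0 : 0 < n.+1%:R :> R by [].
rewrite ler_pdivlMr// -ler_pdivlMl//.
have c1 : 0 < 1 + c^-1 by rewrite addr_gt0// invr_gt0.
apply: (le_trans _ (ler_wpM2r (ltW c1) (inv_growth n))).
have -> : (1 + c * n%:R) * (1 + c^-1) = n.+1%:R + (c * n%:R + c^-1).
  by rewrite -natr1; field; rewrite gt_eqF.
by rewrite lerDl addr_ge0// ?invr_ge0 ?mulr_ge0// ltW.
Qed.

Lemma critical_le1 n : x n <= 1.
Proof.
elim: n => [|n IHn]; first by rewrite x0.
apply: (le_trans (x_decr n)); rewrite lerBlDr (le_trans IHn)// lerDl.
by rewrite mulr_ge0 ?exprn_ge0// ltW.
Qed.

Lemma critical_decrement n : 0 <= x n - x n.+1 <= (a + b) * x n ^+ 2.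
Proof.
apply/andP; split.
  have := x_decr n; have : 0 <= c * x n ^+ 2 by rewrite mulr_ge0 ?exprn_ge0// ltW.
  by lra.
have := x_taylor n; rewrite ler_norml => /andP[_].
have : b * x n ^+ 3 <= b * x n ^+ 2.
  rewrite ler_wpM2l// exprS ler_piMl ?critical_le1// exprn_ge0// ltW//.
by lra.
Qed.

Lemma critical_cvg0 : x @ \oo --> (0 : R).
Proof.
have [C C0 xC] := critical_upper.
apply: (@squeeze_cvgr _ _ _ _ (cst 0) (fun n => C * n.+1%:R^-1)).
- by apply: nearW => n; rewrite /cst (ltW (x_gt0 n)) xC.
- exact: cvg_cst.
- rewrite -[X in _ --> X](mulr0 C); apply: cvgMl_tmp; exact: cvg_harmonic.
Qed.

(** The increments of 1/x_n equal h_n divided by x_{n+1}/x_n and tend to [a]; by Cesaro's theorem so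
    does 1/(n x_n). *)
Lemma critical_cvg : (fun n => n%:R * x n) @ \oo --> a^-1.
Proof.
have x_0 := critical_cvg0.
have xn n : x n != 0 by rewrite gt_eqF.
pose h n := (x n - x n.+1) / x n ^+ 2.
have h_a : h @ \oo --> a.
  apply/subr_cvg0.
  apply: (@squeeze_cvgr _ _ _ _ (fun n => - (b * x n)) (fun n => b * x n)).
  - apply: nearW => n; rewrite -ler_norml.
    have x2 : 0 < x n ^+ 2 by rewrite exprn_gt0.
    have -> : h n - a = (x n - x n.+1 - a * x n ^+ 2) / x n ^+ 2.
      by rewrite /h; field.
    by rewrite normf_div (ger0_norm (ltW x2)) ler_pdivrMr// -mulrA -exprS.
  - rewrite -oppr0 -(mulr0 b); apply: cvgN; exact: cvgMl_tmp.
  - rewrite -(mulr0 b); exact: cvgMl_tmp.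
have ratio : (fun n => x n.+1 / x n) @ \oo --> (1 : R).
  rewrite (_ : (fun n => _) = (fun n => 1 - h n * x n)).
    rewrite -[X in _ --> X]subr0 -(mulr0 a); apply: cvgB; first exact: cvg_cst.
    exact: cvgM.
  by apply/funext => n; rewrite /h; field.
pose v n := (x n.+1)^-1 - (x n)^-1.
have v_a : v @ \oo --> a.
  rewrite (_ : v = (fun n => h n / (x n.+1 / x n))).
    rewrite -[X in _ --> X]divr1; apply: cvgM => //.
    by apply: cvgV; first exact: oner_neq0.
  by apply/funext => n; rewrite /v /h; field; rewrite !xn.
have := cesaro v_a; rewrite /arithmetic_mean/= => mean_a.
have sE n : series v n = (x n)^-1 - 1.
  elim: n => [|n IHn]; first by rewrite /series/= big_geq// x0 invr1 subrr.
  by rewrite seriesSr IHn /v; ring.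
rewrite -cvg_shiftS.
have H : (fun n : nat => n.+1%:R^-1 * (x n.+1)^-1) @ \oo --> a.
  rewrite (_ : (fun n => _) = (fun n => n.+1%:R^-1 * series v n.+1 + n.+1%:R^-1)).
    rewrite -[X in _ --> X]addr0; apply: cvgD; first exact: mean_a.
    exact: cvg_harmonic.
  by apply/funext => n; rewrite sE; ring.
rewrite (_ : (fun n => _) = (fun n : nat => (n.+1%:R^-1 * (x n.+1)^-1)^-1)).
  by apply: cvgV => //; rewrite gt_eqF.
by apply/funext => n /=; rewrite invfM !invrK.
Qed.

End CriticalSurvival.

End RecursiveSequences.

(** * Expectations over the subtrees of a random number of children *)

Notation "\Ex_ P f" := (\int[P]_w (f w)%:E)%E
  (at level 10, P at level 8, f at level 9, format "\Ex_ P  f").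

Section RealExpectation.
Context d (T : measurableType d) (R : realType) (P : probability T R).
Implicit Types f g : T -> R.
Local Open Scope ereal_scope.

Lemma Ex_le f g : measurable_fun setT f -> measurable_fun setT g ->
  (forall w, 0 <= f w)%R -> (forall w, f w <= g w)%R -> \Ex_P f <= \Ex_P g.
Proof.
move=> mf mg f0 fg; apply: ge0_le_integral => //.
- by move=> w _; rewrite lee_fin.
- exact/measurable_EFinP.
- exact/measurable_EFinP.
- by move=> w _; rewrite lee_fin.
Qed.

Lemma Ex_ge0 f : (forall w, 0 <= f w)%R -> 0 <= \Ex_P f.
Proof. by move=> f0; apply: integral_ge0 => w _; rewrite lee_fin. Qed.

Lemma Ex_add f g : measurable_fun setT f -> measurable_fun setT g ->
  (forall w, 0 <= f w)%R -> (forall w, 0 <= g w)%R ->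
  \Ex_P (fun w => f w + g w)%R = \Ex_P f + \Ex_P g.
Proof.
move=> mf mg f0 g0; under eq_integral do rewrite EFinD.
rewrite ge0_integralD//; try exact/measurable_EFinP.
- by move=> w _; rewrite lee_fin.
- by move=> w _; rewrite lee_fin.
Qed.

Lemma Ex_scale f (c : R) : measurable_fun setT f ->
  (forall w, 0 <= f w)%R -> (0 <= c)%R ->
  \Ex_P (fun w => c * f w)%R = c%:E * \Ex_P f.
Proof.
move=> mf f0 c0; under eq_integral do rewrite EFinM.
rewrite ge0_integralZl//; first exact/measurable_EFinP.
by move=> w _; rewrite lee_fin.
Qed.

Lemma Ex_cst (c : R) : \Ex_P (fun=> c) = c%:E.
Proof. by rewrite integral_cst//= [X in (_ * X)%E](@probability_setT _ _ _ P) mule1. Qed.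

Lemma integrable_bounded_fin f (s : R) : measurable_fun setT f ->
  (forall w, 0 <= f w)%R -> \Ex_P f <= s%:E -> P.-integrable setT (EFin \o f).
Proof.
move=> mf f0 fs; apply/integrableP; split; first exact/measurable_EFinP.
under eq_integral do rewrite /= ger0_norm//.
exact: le_lt_trans fs (ltry _).
Qed.

Lemma sqr_integrable f (s : R) : measurable_fun setT f ->
  \Ex_P (fun w => f w ^+ 2)%R <= s%:E -> P.-integrable setT (EFin \o f).
Proof.
move=> mf fs.
have mf2 : measurable_fun setT (fun w => f w ^+ 2)%R by exact: measurable_funX.
have i2 : P.-integrable setT (EFin \o (fun w => f w ^+ 2)%R).
  by apply: integrable_bounded_fin fs => // w; rewrite sqr_ge0.
have ic : P.-integrable setT (EFin \o cst (1 : R)%R).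
  by apply: finite_measure_integrable_cst.
apply: (le_integrable _ _ _ (integrableD _ ic i2)) => //.
  exact/measurable_EFinP.
move=> w _ /=; rewrite lee_fin [leRHS]ger0_norm; last first.
  by rewrite addr_ge0// sqr_ge0.
rewrite -(real_normK (num_real (f w))).
(* Gives the domination |f| <= 1 + f^2. *)
have := sqr_ge0 (`|f w| - 1)%R; have := normr_ge0 (f w).
by rewrite sqrrB; lra.
Qed.

Lemma Ex_addi f g : P.-integrable setT (EFin \o f) ->
  P.-integrable setT (EFin \o g) ->
  \Ex_P (fun w => f w + g w)%R = \Ex_P f + \Ex_P g.
Proof.
by move=> fi gi; under eq_integral do rewrite EFinD; rewrite integralD.
Qed.

Lemma Ex_scalei f (c : R) : P.-integrable setT (EFin \o f) ->
  \Ex_P (fun w => c * f w)%R = c%:E * \Ex_P f.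
Proof. by move=> fi; under eq_integral do rewrite EFinM; rewrite integralZl. Qed.

Lemma integrable_add f g : P.-integrable setT (EFin \o f) ->
  P.-integrable setT (EFin \o g) ->
  P.-integrable setT (EFin \o (fun w => f w + g w)%R).
Proof. by move=> fi gi; exact: (integrableD measurableT fi gi). Qed.

Lemma integrable_scale f (c : R) : P.-integrable setT (EFin \o f) ->
  P.-integrable setT (EFin \o (fun w => c * f w)%R).
Proof. by move=> fi; exact: (integrableZl measurableT c fi). Qed.

Lemma Ex_partition (N : {RV P >-> nat}) f : measurable_fun setT f ->
  (forall w, 0 <= f w)%R ->
  \Ex_P f = \sum_(k <oo) \Ex_P (fun w => (N w == k)%:R * f w)%R.
Proof.
move=> mf f0; pose F k := N @^-1` [set k].
have mF k : measurable (F k) by rewrite -[F k]setTI; exact: measurable_funP.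
have UF : [set: T] = \bigcup_k F k.
  by apply/esym/seteqP; split=> // w _; exists (N w).
rewrite [in LHS]UF ge0_integral_bigcup//.
- apply: eq_eseriesr => k _; rewrite integral_mkcond; apply: eq_integral => w _.
  rewrite patchE; case: ifPn => [/set_mem <-|]; first by rewrite eqxx mul1r.
  by case: eqVneq => [<-|_ _]; [rewrite notin_setE => /(_ erefl)|rewrite mul0r].
- by rewrite -UF; exact/measurable_EFinP.
- by move=> w _; rewrite lee_fin.
- apply/trivIsetP => i j _ _ ij; apply/seteqP; split=> // w [Ni Nj].
  by move: ij; rewrite -Ni -Nj eqxx.
Qed.

End RealExpectation.

Section RandomIndex.
Context d (T : measurableType d) (R : realType) (P : probability T R)
  (children : seq nat -> {RV P >-> nat}).
Hypothesis ind : mutually_independent P (fun v => children v : T -> nat).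
Notation N := (fun v => children v : T -> nat).
Notation fm := (fmeas (R := R) N).
Let mN v : measurable_fun setT (N v).
Proof. exact: measurable_funP. Qed.

Lemma fm_measurable A f : fm A f -> measurable_fun setT f.
Proof. exact: fmeas_measurable. Qed.

(** On the event that [v] has [k] children the variable is [G k]; the event involves the word [v]
    alone and [G k] the words strictly below it. *)
Lemma fm_count v (G : nat -> T -> R) : (forall k, fm (below v) (G k)) ->
  fm (subtree v) (fun w => G (N v w) w).
Proof.
move=> mG _ Y mY; rewrite setTI.
rewrite (_ : _ @^-1` Y = \bigcup_k (N v @^-1` [set k] `&` G k @^-1` Y)); last first.
  apply/seteqP; split=> [w Yw|w [k _ []] /= <- //].
  by exists (N v w).
apply: (@bigcup_measurable _ (g_sigma_algebraType _)) => k _.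
apply: (@measurableI _ (g_sigma_algebraType _)).
  by apply: fsigma1 => //; rewrite /subtree/= prefix_refl.
exact: (sub_fsigma (@below_subtree v)) (fmeas_preimage (mG k) mY).
Qed.

Lemma fm_indic v k : fm [set v] (fun w => (N v w == k)%:R).
Proof. by apply: (fmeas_comp (h := fun n : nat => (n == k)%:R : R)). Qed.

Local Open Scope ereal_scope.

(** This takes the place of conditioning on the number of children: partition by its value, then
    factor each piece, as the indicator and [G k] depend on disjoint sets of words. *)
Lemma Ex_index v (G : nat -> T -> R) : (forall k, fm (below v) (G k)) ->
  (forall k w, (0 <= G k w)%R) ->
  \Ex_P (fun w => G (N v w) w) =
  \sum_(k <oo) (\Ex_P (fun w => (N v w == k)%:R)%R * \Ex_P (G k)).
Proof.
move=> mG G0; rewrite (Ex_partition (children v))//; last first.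
  exact: fm_measurable (fm_count mG).
apply: eq_eseriesr => k _.
rewrite -(fmeas_ge0_integralM mN ind (root_disj v) (@fm_indic v k) (mG k))//.
by apply: eq_integral => w _; case: eqVneq => [->//|_]; rewrite !mul0r.
Qed.

Lemma Ex_index_le v (G : nat -> T -> R) (g : nat -> R) :
  (forall k, fm (below v) (G k)) -> (forall k w, (0 <= G k w)%R) ->
  (forall k, (0 <= g k)%R) -> (forall k, \Ex_P (G k) <= (g k)%:E) ->
  \Ex_P (fun w => G (N v w) w) <= \Ex_P (fun w => g (N v w)).
Proof.
move=> mG G0 g0 Gg; rewrite Ex_index//.
(* The bound [g] is itself a family of constant variables, so both sides decompose with the same
   weights. *)
rewrite (Ex_index (G := fun k _ => g k))//; last first.
  by move=> k; exact: measurable_cst.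
apply: lee_nneseries => k _ //; first by rewrite mule_ge0 ?Ex_ge0.
by rewrite lee_wpmul2l ?Ex_ge0// Ex_cst.
Qed.

Lemma Ex_index_eq v (G : nat -> T -> R) (g : nat -> R) :
  (forall k, fm (below v) (G k)) -> (forall k w, (0 <= G k w)%R) ->
  (forall k, (0 <= g k)%R) -> (forall k, \Ex_P (G k) = (g k)%:E) ->
  \Ex_P (fun w => G (N v w) w) = \Ex_P (fun w => g (N v w)).
Proof.
move=> mG G0 g0 Gg; rewrite Ex_index//.
rewrite (Ex_index (G := fun k _ => g k))//; last first.
  by move=> k; exact: measurable_cst.
by apply: eq_eseriesr => k _; rewrite Gg Ex_cst.
Qed.

Section Siblings.
Context (v : seq nat) (F : nat -> T -> R).
Hypothesis mF : forall i, fm (subtree (rcons v i)) (F i).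

Lemma fm_sum k : fm (branches v k) (fun w => \sum_(i < k) F i w)%R.
Proof.
apply: measurable_sum => i.
exact: (sub_fmeas (@subtree_branches v _ _ (ltn_ord i)) (@mF i)).
Qed.

Lemma fm_prod k : fm (branches v k) (fun w => \prod_(i < k) F i w)%R.
Proof.
apply: measurable_prod => i _.
exact: (sub_fmeas (@subtree_branches v _ _ (ltn_ord i)) (@mF i)).
Qed.

Lemma fm_pair_sum k : fm (branches v k) (fun w => pair_sum (F ^~ w) k)%R.
Proof.
elim: k => [|k IHk].
  rewrite (_ : (fun w => _) = cst 0%R); first exact: measurable_cst.
  by apply/funext => w; rewrite /pair_sum big_ord0.
rewrite (_ : (fun w => _) = fun w =>
    (pair_sum (F ^~ w) k + F k w * \sum_(i < k) F i w)%R); last first.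
  by apply/funext => w; rewrite pair_sumS.
apply: measurable_funD; first exact: (sub_fmeas (@sub_branches _ _) IHk).
apply: measurable_funM; first exact: (sub_fmeas (@subtree_branches v _ _ (ltnSn k)) (@mF k)).
exact: (sub_fmeas (@sub_branches _ _) (@fm_sum k)).
Qed.

Let mFT i : measurable_fun setT (F i). Proof. exact: fm_measurable (@mF i). Qed.
Let msT k : measurable_fun setT (fun w => \sum_(i < k) F i w)%R.
Proof. exact: (fm_measurable (@fm_sum k)). Qed.

Section Nonneg.
Hypothesis F0 : forall i w, (0 <= F i w)%R.
Context (m : R).

Lemma Ex_sum k : (forall i, \Ex_P (F i) = m%:E) ->
  \Ex_P (fun w => \sum_(i < k) F i w)%R = (k%:R * m)%:E.
Proof.
move=> Fm; elim: k => [|k IHk].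
  by under eq_integral do rewrite big_ord0; rewrite Ex_cst mul0r.
under eq_integral do rewrite big_ord_recr/=.
rewrite Ex_add//; [|exact: msT|by move=> w; apply: sumr_ge0].
by rewrite IHk Fm -EFinD -natr1 mulrDl mul1r.
Qed.

Lemma Ex_prod k : (forall i, \Ex_P (F i) = m%:E) ->
  \Ex_P (fun w => \prod_(i < k) F i w)%R = (m ^+ k)%:E.
Proof.
move=> Fm; elim: k => [|k IHk].
  by under eq_integral do rewrite big_ord0; rewrite Ex_cst.
under eq_integral do rewrite big_ord_recr/=.
rewrite (fmeas_ge0_integralM mN ind (branches_disj v k) (@fm_prod k) (@mF k))//.
  by rewrite IHk Fm -EFinM exprSr.
by move=> w; apply: prodr_ge0.
Qed.

Lemma Ex_sum_le k : (0 <= m)%R -> (forall i, \Ex_P (F i) <= m%:E) ->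
  \Ex_P (fun w => \sum_(i < k) F i w)%R <= (k%:R * m)%:E.
Proof.
move=> m0 Fm; elim: k => [|k IHk].
  by under eq_integral do rewrite big_ord0; rewrite Ex_cst mul0r.
under eq_integral do rewrite big_ord_recr/=.
rewrite Ex_add//; [|exact: msT|by move=> w; apply: sumr_ge0].
by rewrite -natr1 mulrDl mul1r EFinD leeD.
Qed.

Lemma Ex_pair_sum_le k : (0 <= m)%R -> (forall i, \Ex_P (F i) <= m%:E) ->
  \Ex_P (fun w => pair_sum (F ^~ w) k) <= (k%:R ^+ 2 * m ^+ 2)%:E.
Proof.
move=> m0 Fm; elim: k => [|k IHk].
  by under eq_integral do rewrite /pair_sum big_ord0; rewrite Ex_cst expr0n mul0r.
under eq_integral do rewrite pair_sumS.
have s0 w : (0 <= \sum_(i < k) F i w)%R by apply: sumr_ge0.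
rewrite Ex_add//; last 4 first.
- exact: fm_measurable (@fm_pair_sum k).
- exact: measurable_funM.
- by move=> w; apply: pair_sum_ge0.
- by move=> w; rewrite mulr_ge0.
under [X in _ + X]eq_integral do rewrite mulrC.
rewrite (fmeas_ge0_integralM mN ind (branches_disj v k) (@fm_sum k) (@mF k))//.
apply: (@le_trans _ _ ((k%:R ^+ 2 * m ^+ 2)%:E + (k%:R * m)%:E * m%:E)).
  by rewrite leeD// lee_pmul ?Ex_ge0// Ex_sum_le.
rewrite -EFinM -EFinD lee_fin -natr1.
have : (0 <= (k%:R + 1) * m ^+ 2)%R by rewrite mulr_ge0// ?addr_ge0// exprn_ge0.
by lra.
Qed.

End Nonneg.

Section SecondMoment.
Context (m s : R).
Hypothesis Fm : forall i, \Ex_P (F i) = m%:E.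
Hypothesis Fs : forall i, \Ex_P (fun w => F i w ^+ 2)%R <= s%:E.

(** Integrability and the mean of the partial sum belong to the induction, since the cross term with
    the next, possibly signed, sibling is factored through them. For [m = 0] the cross terms vanish:
    this is the source of the contraction. *)
Lemma Ex_sqr_sum_le k :
  [/\ P.-integrable setT (EFin \o (fun w => \sum_(i < k) F i w)%R),
      \Ex_P (fun w => \sum_(i < k) F i w)%R = (k%:R * m)%:E &
      \Ex_P (fun w => (\sum_(i < k) F i w) ^+ 2)%R <=
        (k%:R * s + k%:R * (k%:R - 1) * m ^+ 2)%:E].
Proof.
have Fi i : P.-integrable setT (EFin \o F i) by exact: sqr_integrable (Fs i).
elim: k => [|k [Si Sm Ss]].
  split.
  - under eq_fun do rewrite big_ord0; exact: finite_measure_integrable_cst.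
  - by under eq_integral do rewrite big_ord0; rewrite Ex_cst mul0r.
  - under eq_integral do rewrite big_ord0 expr0n/=.
    by rewrite Ex_cst !mul0r addr0.
split.
- under eq_fun do rewrite big_ord_recr/=; exact: integrable_add.
- under eq_integral do rewrite big_ord_recr/=.
  by rewrite Ex_addi// Sm Fm -EFinD -natr1 mulrDl mul1r.
- have Fi2 : P.-integrable setT (EFin \o (fun w => F k w ^+ 2)%R).
    apply: integrable_bounded_fin (Fs k) => [|w]; last exact: sqr_ge0.
    exact: measurable_funX.
  have Si2 : P.-integrable setT (EFin \o (fun w => (\sum_(i < k) F i w) ^+ 2)%R).
    apply: integrable_bounded_fin Ss => [|w]; last exact: sqr_ge0.
    exact: measurable_funX.
  have SF := fmeas_integrableM mN ind (branches_disj v k) (@fm_sum k) (@mF k) Si (Fi k).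
  have SFE := fmeas_integralM mN ind (branches_disj v k) (@fm_sum k) (@mF k) Si (Fi k).
  rewrite (eq_integral (fun w => ((\sum_(i < k) F i w) ^+ 2 +
      (2 * ((\sum_(i < k) F i w) * F k w) + F k w ^+ 2))%:E)); last first.
    by move=> w _; rewrite big_ord_recr/= sqrrD; congr EFin; ring.
  rewrite Ex_addi//; last exact/integrable_add/Fi2/integrable_scale.
  rewrite Ex_addi//; last exact: integrable_scale.
  rewrite Ex_scalei// SFE Sm Fm -!EFinM.
  apply: (le_trans (leeD Ss (leeD (le_refl _) (Fs k)))).
  by rewrite -!EFinD lee_fin -natr1; lra.
Qed.

End SecondMoment.

End Siblings.

End RandomIndex.

(** * Almost sure convergence from summable expectations *)

Section SummableExpectations.
Context d (T : measurableType d) (R : realType) (P : probability T R).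
Implicit Types f : nat -> T -> R.

(** By monotone convergence the sum has expectation at most [B], so it is finite almost
    everywhere. *)
Lemma ae_cvg_series f (u : nat -> R) (B : R) :
  (forall n, measurable_fun setT (f n)) -> (forall n w, 0 <= f n w) ->
  (forall n, (\Ex_P (f n) <= (u n)%:E)%E) ->
  (forall n, \sum_(i < n) u i <= B) ->
  {ae P, forall w, cvgn (series (f ^~ w))}.
Proof.
move=> mf f0 fu uB.
pose F w := (\sum_(n <oo) (f n w)%:E)%E.
have mF : measurable_fun setT F.
  apply: ge0_emeasurable_sum => [k w _ _|k _]; first by rewrite lee_fin.
  exact/measurable_EFinP.
have F0 w : (0 <= F w)%E by apply: nneseries_ge0 => n _ _; rewrite lee_fin.
have FB : (\int[P]_w F w <= B%:E)%E.
  rewrite integral_nneseries//; last 2 first.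
  - by move=> n; exact/measurable_EFinP.
  - by move=> n w _; rewrite lee_fin.
  apply: lime_le => [|]; first by apply: is_cvg_nneseries => n _ _; exact: Ex_ge0.
  apply: nearW => n; rewrite big_mkord.
  apply: (@le_trans _ _ (\sum_(i < n) (u i)%:E)%E); first exact: lee_sum.
  by rewrite sumEFin lee_fin.
have iF : P.-integrable setT F.
  apply/integrableP; split=> //.
  under eq_integral do rewrite gee0_abs//.
  exact: le_lt_trans FB (ltry _).
apply: filterS (integrable_ae measurableT iF) => w /(_ I) Fw.
apply: nondecreasing_is_cvgn.
  by apply/nondecreasing_seqP => n; rewrite seriesSr lerDl.
exists (fine (F w)) => _ [n _ <-].
rewrite -lee_fin fineK// /series/= -sumEFin.
apply: nneseries_lim_ge => i _ _; rewrite lee_fin//.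
Qed.

Lemma ae_cvg_to0 f (u : nat -> R) (B : R) :
  (forall n, measurable_fun setT (f n)) ->
  (forall n, (\Ex_P (fun w => f n w ^+ 2) <= (u n)%:E)%E) ->
  (forall n, \sum_(i < n) u i <= B) ->
  {ae P, forall w, (f ^~ w) @ \oo --> (0 : R)}.
Proof.
move=> mf fu uB.
have mf2 n : measurable_fun setT (fun w => f n w ^+ 2) by exact: measurable_funX.
apply: filterS (ae_cvg_series mf2 _ fu uB) => [w /cvg_series_cvg_0 f2|n w]; last first.
  exact: sqr_ge0.
apply/cvgr0Pnorm_lt => e e0.
have e2 : 0 < e ^+ 2 by rewrite exprn_gt0.
have [m _ Hm] := cvgr0_norm_lt _ f2 _ e2; exists m => // n /Hm /=.
by rewrite normrX ltr_pXn2r// nnegrE ltW.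
Qed.

Lemma ae_cvg_increments f (u : nat -> R) (B : R) :
  (forall n, measurable_fun setT (f n)) ->
  (forall n, (\Ex_P (fun w => `|f n.+1 w - f n w|) <= (u n)%:E)%E) ->
  (forall n, \sum_(i < n) u i <= B) ->
  {ae P, forall w, cvgn (f ^~ w)}.
Proof.
move=> mf fu uB.
have mdf n : measurable_fun setT (fun w => `|f n.+1 w - f n w|).
  by apply: measurableT_comp => //; exact: measurable_funB.
apply: filterS (ae_cvg_series mdf _ fu uB) => // w sf.
have /normed_cvg/cvg_ex[l] : cvgn [normed series (fun n => f n.+1 w - f n w)] by exact: sf.
set s := series _ => sl.
apply/cvg_ex; exists (f 0%N w + l).
have -> : f ^~ w = (fun n => f 0%N w + s n).
  apply/funext => n; rewrite /s /series/=.
  by rewrite telescope_sumr//; ring.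
by apply: cvgD => //; exact: cvg_cst.
Qed.

End SummableExpectations.

Section PartialSums.
Context (R : realFieldType).

Lemma sum_inv_sqr_le n : \sum_(i < n) (i.+1%:R ^+ 2)^-1 <= 2 :> R.
Proof.
(* Telescopes 1/x^2 <= 2/(x(x+1)), valid for x >= 1 with equality at x = 1. *)
suff : \sum_(i < n) (i.+1%:R ^+ 2)^-1 <= 2 - 2 / n.+1%:R :> R.
  by move/le_trans; apply; rewrite lerBlDr lerDl divr_ge0.
elim: n => [|n IHn]; first by rewrite big_ord0 divr1 subrr.
rewrite big_ord_recr/=; apply: (le_trans (lerD IHn (lexx _))).
have n0 : 0 < n.+1%:R :> R by [].
have -> : n.+2%:R = n.+1%:R + 1 :> R by rewrite natr1.
set x := n.+1%:R in n0 *.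
have x1 : 1 <= x by rewrite ler1n.
have -> : 2 - 2 / (x + 1) = 2 - 2 / x + (x ^+ 2)^-1 + (x - 1) / (x ^+ 2 * (x + 1)).
  by field; rewrite !gt_eqF// addr_gt0.
by rewrite lerDl divr_ge0 ?subr_ge0// mulr_ge0 ?exprn_ge0// ?addr_ge0// ltW.
Qed.

Lemma sum_geometric_le (x : R) n : 0 <= x < 1 ->
  \sum_(i < n) x ^+ i <= (1 - x)^-1.
Proof.
move=> /andP[x0 x1]; have x1' : 0 < 1 - x by rewrite subr_gt0.
rewrite -(ler_pM2l x1') mulfV ?gt_eqF// -opprB mulNr -subrX1 opprB.
by rewrite lerBlDr lerDl exprn_ge0.
Qed.

End PartialSums.

(** * Moment estimates on the Galton-Watson tree *)

Section GaltonWatson.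
Context (R : realType) (d0 d : measure_display)
  (T0 : measurableType d0) (T : measurableType d)
  (P0 : probability T0 R) (P : probability T R)
  (Z : {RV P0 >-> nat}) (children : seq nat -> {RV P >-> nat}).
Hypotheses (Z1 : forall w, (1 <= Z w)%N) (Z_mean : (1 < progeny_mean Z)%E)
  (Z4 : (progeny_moment4 Z < +oo)%E) (gw : galton_watson Z children).

Notation N := (fun v => children v : T -> nat).
Let ind : mutually_independent P N := gw.2.
Notation fm := (fmeas (R := R) N).
Let mN v : measurable_fun setT (N v).
Proof. exact: measurable_funP. Qed.

(** * Means of functions of the offspring number *)

Let mean (h : nat -> R) : R := fine (\Ex_P0 (fun w => h (Z w))).
(** Growth allowed by the fourth moment. Restricting to [0 < k], where [Z] takes its values, lets
    k^4 dominate constants too; under this condition the [fine] in [mean] discards nothing. *)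
Let dominated (h : nat -> R) :=
  exists2 C : R, 0 <= C & forall k, (0 < k)%N -> `|h k| <= C * k%:R ^+ 4.

Let mcomp d' (T' : measurableType d') (X : T' -> nat) (h : nat -> R) :
  measurable_fun setT X -> measurable_fun setT (fun w => h (X w)).
Proof. by move=> mX; apply: (measurableT_comp (f := h)). Qed.

Let mZ (h : nat -> R) : measurable_fun setT (fun w => h (Z w)).
Proof. by apply: mcomp; exact: measurable_funP. Qed.

Let integrable_mean h : dominated h -> P0.-integrable setT (EFin \o (fun w => h (Z w))).
Proof.
move=> [C C0 hC]; apply: (@le_integrable _ _ _ _ _ _ _
    (EFin \o (fun w => C * (Z w)%:R ^+ 4))) => //.
- exact/measurable_EFinP/mZ.
- move=> w _ /=; rewrite lee_fin [leRHS]ger0_norm ?hC ?Z1//.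
  by rewrite mulr_ge0// exprn_ge0.
- apply: integrable_scale; apply/integrableP; split.
    exact/measurable_EFinP/(mZ (fun k => k%:R ^+ 4)).
  under eq_integral do rewrite /= ger0_norm ?exprn_ge0//.
  by move: Z4; rewrite /progeny_moment4 unlock.
Qed.

Let meanE h : dominated h -> \Ex_P0 (fun w => h (Z w)) = (mean h)%:E.
Proof. by move=> /integrable_mean hi; rewrite fineK// integrable_fin_num. Qed.

Let lawE v (h : nat -> R) : (forall k, 0 <= h k) -> dominated h ->
  \Ex_P (fun w => h (N v w)) = (mean h)%:E.
Proof.
move=> h0 hd; rewrite -meanE//.
have mh : measurable_fun setT (EFin \o h) by exact/measurable_EFinP.
have h0' k : (0 <= (EFin \o h) k)%E by rewrite lee_fin.
have := ge0_integral_distribution (children v) mh h0'.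
have := ge0_integral_distribution Z mh h0'.
move=> <- <-; apply: eq_measure_integral => A mA _; exact: gw.1.
Qed.

Let meanD f g : dominated f -> dominated g ->
  mean (fun k => f k + g k) = mean f + mean g.
Proof.
move=> df dg; apply: EFin_inj; rewrite EFinD -!meanE//.
  by rewrite -Ex_addi//; exact: integrable_mean.
move: df dg => [C C0 fC] [D D0 gD]; exists (C + D); first exact: addr_ge0.
move=> k k0; rewrite mulrDl (le_trans (ler_normD _ _))// lerD ?fC ?gD//.
Qed.

Let dominatedZ c f : dominated f -> dominated (fun k => c * f k).
Proof.
move=> [C C0 fC]; exists (`|c| * C); first exact: mulr_ge0.
by move=> k k0; rewrite normrM -mulrA ler_wpM2l// fC.
Qed.

Let meanZ c f : dominated f -> mean (fun k => c * f k) = c * mean f.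
Proof.
move=> df; apply: EFin_inj; rewrite EFinM -!meanE//; last exact: dominatedZ.
by rewrite -Ex_scalei//; exact: integrable_mean.
Qed.

Let mean_le f g : dominated f -> dominated g ->
  (forall k, (0 < k)%N -> f k <= g k) -> mean f <= mean g.
Proof.
move=> df dg fg; rewrite -lee_fin -!meanE//; apply: le_integral => //.
- exact: integrable_mean.
- exact: integrable_mean.
- by move=> w _; rewrite lee_fin fg.
Qed.

Let dominated_pow j : (j <= 4)%N -> dominated (fun k => k%:R ^+ j).
Proof.
move=> j4; exists 1 => // k k0; rewrite mul1r ger0_norm ?exprn_ge0//.
by rewrite ler_weXn2l// ler1n.
Qed.

Let dominatedD f g : dominated f -> dominated g -> dominated (fun k => f k + g k).
Proof.
move=> [C C0 fC] [D D0 gD]; exists (C + D); first exact: addr_ge0.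
by move=> k k0; rewrite mulrDl (le_trans (ler_normD _ _))// lerD ?fC ?gD.
Qed.

Let mu : R := fine (progeny_mean Z).
Let p : R := mu^-1.
Let phi2 : R := fine (pgf_deriv2_at1 Z).
Let m (j : nat) : R := mean (fun k => k%:R ^+ j).

Let m1E : m 1 = mu.
Proof. by rewrite /mu /progeny_mean unlock. Qed.

Let phi2E : mean (fun k => k%:R * (k%:R - 1)) = phi2.
Proof. by rewrite /phi2 /pgf_deriv2_at1 unlock. Qed.

Let dominated1 : dominated (fun=> 1).
Proof. exact: (dominated_pow (j := 0)). Qed.

Let dominated_id : dominated (fun k => k%:R).
Proof. exact: (dominated_pow (j := 1)). Qed.

Let dominated_phi2 : dominated (fun k => k%:R * (k%:R - 1)).
Proof.
rewrite (_ : (fun k => _) = (fun k => k%:R ^+ 2 + (-1) * k%:R)); last first.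
  by apply/funext => k; ring.
by apply: dominatedD; [exact: dominated_pow|exact: dominatedZ].
Qed.

Let mean1 c : mean (fun=> c) = c.
Proof. by rewrite /mean Ex_cst. Qed.

Let mu1 : 1 < mu.
Proof.
rewrite -lte_fin -m1E -meanE; last exact: (dominated_pow (j := 1)).
by move: Z_mean; rewrite /progeny_mean unlock.
Qed.

Let mu0 : 0 < mu. Proof. exact: lt_trans mu1. Qed.
Let p0 : 0 < p. Proof. by rewrite invr_gt0. Qed.
Let p1 : p < 1. Proof. by rewrite invf_lt1. Qed.
Let pmu : p * mu = 1. Proof. by rewrite mulVf// gt_eqF. Qed.

Let phi2_gt0 : 0 < phi2.
Proof.
have E : mean (fun k => k%:R + (-1) * 1) = mu - 1.
  by rewrite meanD//; [rewrite meanZ// mean1 mulN1r -m1E|exact: dominatedZ].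
(* From k(k-1) >= k-1 for k >= 1. *)
have : mu - 1 <= phi2.
  rewrite -phi2E -E; apply: mean_le => //.
    by apply: dominatedD => //; exact: dominatedZ.
  move=> k k0; have : 1 <= k%:R :> R by rewrite ler1n.
  by have := sqr_ge0 (k%:R - 1 : R); rewrite sqrrB; lra.
by have := mu1; lra.
Qed.

(** * Survival and normalized size of the random subtrees *)

Let tree w : seq nat -> nat := fun v => children v w.

Let q n v w : R := surv p (tree w) n v.
Let W n v w : R := p ^+ n * (gsize (tree w) n v)%:R.

Let qS n v w : q n.+1 v w = 1 - \prod_(i < N v w) (1 - p * q n (rcons v i) w).
Proof. by []. Qed.

Let WS n v w : W n.+1 v w = p * \sum_(i < N v w) W n (rcons v i) w.
Proof. by rewrite /W/= natr_sum exprS -mulrA mulr_sumr. Qed.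

Let q01 n v w : 0 <= q n v w <= 1.
Proof. by apply: surv_itv; rewrite !ltW. Qed.

Let W0 n v w : 0 <= W n v w.
Proof. by rewrite mulr_ge0// exprn_ge0// ltW. Qed.

Let pq01 n v w : 0 <= p * q n v w <= 1.
Proof.
have /andP[q0 q1] := q01 n v w.
by rewrite mulr_ge0 ?(ltW p0)//= mulr_ile1// ltW.
Qed.

Let fm_scale A (c : R) f : fm A f -> fm A (fun w => c * f w).
Proof. by move=> mf; apply: measurable_funM => //; exact: measurable_cst. Qed.

Let fm_below v k f : fm (branches v k) f -> fm (below v) f.
Proof. by move=> mf; exact: (sub_fmeas (@branches_below v k) mf). Qed.

Let fm_q n v : fm (subtree v) (q n v).
Proof.
elim: n v => [|n IHn] v; first exact: measurable_cst.
pose G k w := 1 - \prod_(i < k) (1 - p * q n (rcons v i) w).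
apply: (fm_count (G := G)) => k; apply: fm_below.
apply: measurable_funB; first exact: measurable_cst.
apply: (fm_prod (F := fun i w => 1 - p * q n (rcons v i) w)) => i.
apply: measurable_funB; first exact: measurable_cst.
by apply: fm_scale; exact: IHn.
Qed.

Let fm_W n v : fm (subtree v) (W n v).
Proof.
elim: n v => [|n IHn] v.
  rewrite (_ : W 0 v = fun=> 1); first exact: measurable_cst.
  by apply/funext => w; rewrite /W expr0 mul1r.
pose G k w := p * \sum_(i < k) W n (rcons v i) w.
rewrite (_ : W n.+1 v = fun w => G (N v w) w); last first.
  by apply/funext => w; rewrite WS.
apply: (fm_count (G := G)) => k; apply: fm_below.
by apply: fm_scale; apply: (fm_sum (F := fun i => W n (rcons v i))).
Qed.

Let mq n v : measurable_fun setT (q n v). Proof. exact: fm_measurable (@fm_q n v). Qed.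
Let mW n v : measurable_fun setT (W n v). Proof. exact: fm_measurable (@fm_W n v). Qed.

(** * The annealed survival probability *)

Let dominated_exp c : 0 <= c <= 1 -> dominated (fun k => c ^+ k).
Proof.
move=> /andP[c0 c1]; exists 1 => // k k0.
rewrite mul1r ger0_norm ?exprn_ge0// (le_trans (exprn_ile1 _ _ _))//.
by rewrite exprn_ege1// ler1n.
Qed.

(** The iteration a_{n+1} = 1 - phi(1 - p a_n), which is survival of the Galton-Watson process whose
    offspring is thinned by [p]; its offspring mean is p mu = 1, hence critical. *)
Fixpoint annealed n : R :=
  if n is m.+1 then 1 - mean (fun k => (1 - p * annealed m) ^+ k) else 1.

Let mean_exp_itv c : 0 <= c <= 1 -> 0 <= mean (fun k => c ^+ k) <= c.
Proof.
move=> c01; have /andP[c0 c1] := c01; apply/andP; split.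
  by apply/fine_ge0/Ex_ge0 => w; rewrite exprn_ge0.
rewrite -[leRHS]mean1; apply: mean_le; first exact: dominated_exp.
  rewrite (_ : (fun=> c) = fun k => c * 1); first exact: dominatedZ.
  by apply/funext => k; rewrite mulr1.
move=> [//|k] _; rewrite exprS ler_piMr// exprn_ile1//.
Qed.

Let annealed_itv n : 0 < annealed n <= 1.
Proof.
elim: n => [|n /andP[a0 a1]]; first by rewrite /= ltr01 lexx.
have pa0 : 0 < p * annealed n by rewrite mulr_gt0.
have pa1 : p * annealed n <= 1 by rewrite mulr_ile1// ltW.
have /mean_exp_itv/andP[m0 m1] : 0 <= 1 - p * annealed n <= 1 by apply/andP; split; lra.
by apply/andP; split => /=; lra.
Qed.

Let pannealed_itv n : 0 <= p * annealed n <= 1.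
Proof.
have /andP[a0 a1] := annealed_itv n.
by rewrite mulr_ge0 ?mulr_ile1// ltW.
Qed.

Let Ex_one_sub (f : T -> R) c : measurable_fun setT f -> (forall w, 0 <= f w <= 1) ->
  \Ex_P f = c%:E -> \Ex_P (fun w => 1 - f w) = (1 - c)%:E.
Proof.
move=> mf f01 fc.
have fi : P.-integrable setT (EFin \o f).
  apply: (integrable_bounded_fin (s := c)) => //; last by rewrite fc.
  by move=> w; case/andP: (f01 w).
rewrite (eq_integral (fun w => (1 + (-1) * f w)%:E)); last first.
  by move=> w _; rewrite mulN1r.
rewrite (Ex_addi (f := fun=> 1)) ?Ex_scalei ?fc ?Ex_cst//.
- by rewrite -EFinM -EFinD mulN1r.
- exact: finite_measure_integrable_cst.
- exact: integrable_scale.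
Qed.

(** Given [k] children, independence of the siblings turns the product into the power (1 - p a_n)^k,
    whose average over [k] is the recursion of [annealed]. *)
Let Ex_q n v : \Ex_P (q n v) = (annealed n)%:E.
Proof.
elim: n v => [|n IHn] v; first by rewrite [LHS]Ex_cst.
pose F i w := 1 - p * q n (rcons v i) w.
have F01 i w : 0 <= F i w <= 1.
  by have /andP[? ?] := pq01 n (rcons v i) w; apply/andP; split; rewrite /F; lra.
have mF i : fm (subtree (rcons v i)) (F i).
  apply: measurable_funB; first exact: measurable_cst.
  by apply: fm_scale; exact: fm_q.
have FE i : \Ex_P (F i) = (1 - p * annealed n)%:E.
  apply: Ex_one_sub.
  - by apply: measurable_funM => //; exact: measurable_cst.
  - by move=> w; exact: pq01.
  - rewrite Ex_scale ?IHn -?EFinM// ?(ltW p0)//.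
    by move=> w; case/andP: (q01 n (rcons v i) w).
pose G k w := \prod_(i < k) F i w.
have G01 k w : 0 <= G k w <= 1.
  rewrite prodr_ge0 => [|i _]; last by case/andP: (F01 i w).
  by apply: prodr_ile1 => i _.
have mG k : fm (below v) (G k) by apply: fm_below; apply: (fm_prod (F := F)).
have GE : \Ex_P (fun w => G (N v w) w) =
    (mean (fun k => (1 - p * annealed n) ^+ k))%:E.
  have pa : 0 <= 1 - p * annealed n <= 1.
    by have /andP[? ?] := pannealed_itv n; apply/andP; split; lra.
  rewrite (Ex_index_eq ind mG (g := fun k => (1 - p * annealed n) ^+ k)).
  - rewrite lawE//; last exact: dominated_exp.
    by move=> k; rewrite exprn_ge0//; case/andP: pa.
  - by move=> k w; case/andP: (G01 k w).
  - by move=> k; rewrite exprn_ge0//; case/andP: pa.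
  - move=> k; apply: (Ex_prod ind mF) => //.
    by move=> i w; case/andP: (F01 i w).
rewrite [LHS](_ : _ = \Ex_P (fun w => 1 - G (N v w) w))//.
apply: Ex_one_sub => //; first exact: fm_measurable (fm_count mG).
Qed.

Let Ex_N v : \Ex_P (fun w => (N v w)%:R) = mu%:E.
Proof.
by rewrite -m1E; apply: (lawE v (h := fun k => k%:R ^+ 1)) => //; exact: dominated_pow.
Qed.

Let Ex_W n v : \Ex_P (W n v) = 1%:E.
Proof.
elim: n v => [|n IHn] v.
  by under eq_integral do rewrite /W expr0 mul1r; rewrite [LHS]Ex_cst.
pose G k w := \sum_(i < k) W n (rcons v i) w.
have G0 k w : 0 <= G k w by apply: sumr_ge0.
have mG k : fm (below v) (G k).
  by apply: fm_below; apply: (fm_sum (F := fun i => W n (rcons v i))).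
under eq_integral do rewrite WS.
rewrite (@Ex_scale _ _ _ P (fun w => G (N v w) w))//; last 2 first.
- exact: fm_measurable (fm_count mG).
- exact: ltW.
rewrite (Ex_index_eq ind mG (g := fun k => k%:R * 1))//.
- by under eq_integral do rewrite mulr1; rewrite Ex_N -EFinM pmu.
- move=> k; apply: (Ex_sum (F := fun i => W n (rcons v i))) => // i.
Qed.

Let dominated_one_sub_exp y : 0 <= y <= 1 ->
  dominated (fun k => 1 + (-1) * (1 - y) ^+ k).
Proof.
move=> /andP[y0 y1]; apply: dominatedD => //; apply/dominatedZ/dominated_exp.
by apply/andP; split; lra.
Qed.

Let annealedS n :
  annealed n.+1 = mean (fun k => 1 + (-1) * (1 - p * annealed n) ^+ k).
Proof.
have /andP[a0 a1] := pannealed_itv n.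
have dom : dominated (fun k => (1 - p * annealed n) ^+ k).
  by apply: dominated_exp; apply/andP; split; lra.
by rewrite meanD ?meanZ ?mean1 ?mulN1r//; exact: dominatedZ.
Qed.

Let annealed_decr n :
  annealed n.+1 <= annealed n - (p ^+ 2 * (mu - 1)) * annealed n ^+ 2.
Proof.
have y01 := pannealed_itv n.
pose y := p * annealed n.
(* The function averaged is k y - (k-1) y^2, the bound of [one_sub_exp_le]; criticality p mu = 1
   makes its linear part average to a_n. *)
have -> : annealed n - (p ^+ 2 * (mu - 1)) * annealed n ^+ 2 =
    mean (fun k => (y - y ^+ 2) * k%:R + y ^+ 2 * 1).
  rewrite meanD ?meanZ ?mean1//; try exact: dominatedZ.
  rewrite (_ : mean (fun k => k%:R) = mu); last by rewrite -m1E.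
  transitivity (p * mu * annealed n - (p ^+ 2 * (mu - 1)) * annealed n ^+ 2).
    by rewrite pmu mul1r.
  by rewrite /y; ring.
rewrite annealedS; apply: mean_le; first exact: dominated_one_sub_exp.
  by apply: dominatedD; exact: dominatedZ.
by move=> k k0; have := one_sub_exp_le k0 y01; rewrite -/y; lra.
Qed.

Let annealed_taylor n :
  `|annealed n - annealed n.+1 - (p ^+ 2 * phi2 / 2) * annealed n ^+ 2| <=
  (p ^+ 3 * m 3) * annealed n ^+ 3.
Proof.
have y01 := pannealed_itv n.
pose y := p * annealed n.
(* The absolute value is split into [h (-1) <= 0 <= h 1], inequalities that pass to the mean. *)
pose h (s : R) k : R := (1 + (-1) * (1 - y) ^+ k) +
  ((- y) * k%:R + (y ^+ 2 / 2 * (k%:R * (k%:R - 1)) + (s * y ^+ 3) * k%:R ^+ 3)).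
have dom3 : dominated (fun k => k%:R ^+ 3) by exact: dominated_pow.
have domh s : dominated (h s).
  apply: dominatedD; first exact: dominated_one_sub_exp.
  apply: dominatedD; first exact: dominatedZ.
  by apply: dominatedD; exact: dominatedZ.
have hE s : mean (h s) = annealed n.+1 - annealed n +
    (p ^+ 2 * phi2 / 2) * annealed n ^+ 2 + s * (p ^+ 3 * m 3) * annealed n ^+ 3.
  rewrite meanD//; last first.
  - apply: dominatedD; first exact: dominatedZ.
    by apply: dominatedD; exact: dominatedZ.
  - exact: dominated_one_sub_exp.
  rewrite -annealedS meanD//; last first.
  - by apply: dominatedD; exact: dominatedZ.
  - exact: dominatedZ.
  rewrite meanD//; try exact: dominatedZ.
  rewrite !meanZ// (_ : mean (fun k => k%:R) = mu); last by rewrite -m1E.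
  rewrite phi2E -/(m 3).
  transitivity (annealed n.+1 - p * mu * annealed n +
    (p ^+ 2 * phi2 / 2) * annealed n ^+ 2 + s * (p ^+ 3 * m 3) * annealed n ^+ 3).
    by rewrite /y; field.
  by rewrite pmu mul1r.
have H k : `|1 - (1 - y) ^+ k - k%:R * y + k%:R * (k%:R - 1) / 2 * y ^+ 2| <=
    k%:R ^+ 3 * y ^+ 3 by exact: one_sub_exp_taylor.
have z0 : mean (fun k => 0 * 1) = 0 by rewrite meanZ// mul0r.
have : mean (h (-1)) <= mean (fun=> 0 * 1).
  apply: mean_le => //; first exact: dominatedZ.
  by move=> k _; have := H k; rewrite ler_norml /h => /andP[_]; lra.
have : mean (fun=> 0 * 1) <= mean (h 1).
  apply: mean_le => //; first exact: dominatedZ.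
  by move=> k _; have := H k; rewrite ler_norml /h => /andP[+ _]; lra.
by rewrite !hE z0 ler_norml => ? ?; apply/andP; split; lra.
Qed.

Let a_gt0 : 0 < p ^+ 2 * phi2 / 2.
Proof. by rewrite divr_gt0// mulr_gt0// exprn_gt0. Qed.

Let b_ge0 : 0 <= p ^+ 3 * m 3.
Proof.
rewrite mulr_ge0 ?exprn_ge0 ?(ltW p0)//.
by apply/fine_ge0/Ex_ge0 => w; rewrite exprn_ge0.
Qed.

Let c_gt0 : 0 < p ^+ 2 * (mu - 1).
Proof. by rewrite mulr_gt0 ?exprn_gt0// subr_gt0. Qed.

Let annealed_gt0 n : 0 < annealed n. Proof. by case/andP: (annealed_itv n). Qed.

Let annealed_decay : exists2 C, 0 <= C & forall n, annealed n <= C / n.+1%:R.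
Proof. exact: critical_upper c_gt0 (erefl : annealed 0 = 1) annealed_gt0 annealed_decr. Qed.

Let annealed_cvg : (fun n => n%:R * annealed n) @ \oo --> (p ^+ 2 * phi2 / 2)^-1.
Proof.
exact: critical_cvg a_gt0 c_gt0 (erefl : annealed 0 = 1) annealed_gt0
  annealed_decr annealed_taylor.
Qed.

Let annealed_decrement n : 0 <= annealed n - annealed n.+1 <=
  (p ^+ 2 * phi2 / 2 + p ^+ 3 * m 3) * annealed n ^+ 2.
Proof.
exact: critical_decrement b_ge0 c_gt0 (erefl : annealed 0 = 1) annealed_gt0
  annealed_decr annealed_taylor n.
Qed.

(** Averaging k s + k(k-1) x^2 over the number of children gives mu s + phi2 x^2, and p^2 mu = p. It
    is applied with x = a_n to [q], x = 1 to [W], and x = 0 to [dW] and [D], where it is a pure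
    contraction. *)
Let Ex_sqr_step v (F : nat -> T -> R) (x s : R) :
  (forall i, fm (subtree (rcons v i)) (F i)) -> 0 <= s ->
  (forall i, \Ex_P (F i) = x%:E) ->
  (forall i, \Ex_P (fun w => F i w ^+ 2) <= s%:E)%E ->
  (\Ex_P (fun w => (p * \sum_(i < N v w) F i w) ^+ 2) <=
    (p * s + p ^+ 2 * phi2 * x ^+ 2)%:E)%E.
Proof.
move=> mF s0 Fx Fs.
pose G k w := (\sum_(i < k) F i w) ^+ 2.
have mG k : fm (below v) (G k).
  by apply: fm_below; apply: measurable_funX; apply: (fm_sum (F := F)).
have G0 k w : 0 <= G k w by exact: sqr_ge0.
pose g k : R := s * k%:R + x ^+ 2 * (k%:R * (k%:R - 1)).
have g0 k : 0 <= g k.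
  have kk : 0 <= k%:R * (k%:R - 1) :> R.
    by case: k => [|k]; [rewrite mul0r|rewrite -natr1 addrK mulr_ge0].
  by rewrite addr_ge0// mulr_ge0// sqr_ge0.
have dg : dominated g by apply: dominatedD; exact: dominatedZ.
have Gg k : (\Ex_P (G k) <= (g k)%:E)%E.
  have [_ _ H] := Ex_sqr_sum_le ind mF Fx Fs k.
  by apply: (le_trans H); rewrite lee_fin /g; lra.
have := Ex_index_le ind mG G0 g0 Gg.
rewrite lawE// /g meanD ?meanZ//; try exact: dominatedZ.
rewrite phi2E (_ : mean (fun k => k%:R) = mu); last by rewrite -m1E.
move=> H.
under eq_integral do rewrite exprMn.
rewrite (@Ex_scale _ _ _ P (fun w => G (N v w) w))//; last 2 first.
- exact: fm_measurable (fm_count mG).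
- exact: sqr_ge0.
apply: (@le_trans _ _ ((p ^+ 2)%:E * (s * mu + x ^+ 2 * phi2)%:E)%E).
  by rewrite lee_wpmul2l// lee_fin sqr_ge0.
rewrite -EFinM lee_fin.
rewrite [leLHS](_ : _ = p * mu * (p * s) + p ^+ 2 * phi2 * x ^+ 2); last by ring.
by rewrite pmu mul1r.
Qed.

Let Ex_q2 : exists2 C, 0 <= C &
  forall n v, (\Ex_P (fun w => q n v w ^+ 2) <= (C / n.+1%:R ^+ 2)%:E)%E.
Proof.
have [Ca Ca0 HCa] := annealed_decay.
(* The bound of [Ex_sqr_step] iterated from q_0 = 1; it applies because q_{n+1} is at most p times
   the sum over the children. The source is O(n^-2), hence the exponent 2 below. *)
pose s := fix s n := if n is k.+1 then p * s k + p ^+ 2 * phi2 * annealed k ^+ 2 else 1 : R.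
have pphi : 0 <= p ^+ 2 * phi2 by rewrite mulr_ge0 ?exprn_ge0// ltW.
have s0 n : 0 <= s n.
  elim: n => //= n IHn; rewrite addr_ge0// mulr_ge0 ?(ltW p0)//.
  by rewrite exprn_ge0// ltW.
have [|||C C0 HC] := @contraction_decay R s p (p ^+ 2 * phi2 * Ca ^+ 2) 2 s0.
- by rewrite p1 ltW.
- by rewrite mulr_ge0// exprn_ge0.
- move=> n /=; rewrite lerD2l -[leRHS]mulrA ler_wpM2l// -expr_div_n.
  by rewrite lerXn2r ?nnegrE ?divr_ge0 ?HCa// ltW.
exists C => // n v; apply: (@le_trans _ _ (s n)%:E); last by rewrite lee_fin HC.
elim: n v => [|n IHn] v.
  by under eq_integral do rewrite /= expr1n; rewrite [leLHS]Ex_cst.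
apply: le_trans (Ex_sqr_step (fun i => @fm_q n (rcons v i)) (s0 n)
  (fun i => Ex_q n (rcons v i)) (fun i => IHn (rcons v i))).
have mqn i : measurable_fun setT (q n i) by exact: mq.
apply: Ex_le => [||w|w].
- exact: measurable_funX.
- pose G k w := p * \sum_(i < k) q n (rcons v i) w.
  apply: measurable_funX; apply: (fm_measurable (fm_count (G := G) _)) => k.
  apply: fm_below; apply: fm_scale.
  exact: (fm_sum (F := fun i => q n (rcons v i)) (fun i => @fm_q n (rcons v i))).
- exact: sqr_ge0.
- have /andP[_] := one_sub_prod_bounds (N v w) (fun i => pq01 n (rcons v i) w).
  rewrite -mulr_sumr -qS => H; have /andP[qn0 _] := q01 n.+1 v w.
  by rewrite lerXn2r ?nnegrE// (le_trans qn0).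
Qed.

Let Ex_W2 : exists2 C, 0 <= C &
  forall n v, (\Ex_P (fun w => W n v w ^+ 2) <= C%:E)%E.
Proof.
pose s := fix s n := if n is k.+1 then p * s k + p ^+ 2 * phi2 * 1 ^+ 2 else 1 : R.
have pphi : 0 <= p ^+ 2 * phi2 by rewrite mulr_ge0 ?exprn_ge0// ltW.
have s0 n : 0 <= s n.
  by elim: n => //= n IHn; rewrite expr1n mulr1 addr_ge0// mulr_ge0 ?(ltW p0).
(* Exponent 0: the source term is constant and only boundedness is claimed. *)
have [|||C C0 HC] := @contraction_decay R s p (p ^+ 2 * phi2) 0 s0.
- by rewrite p1 ltW.
- by [].
- by move=> n /=; rewrite expr1n mulr1 expr0 divr1.
exists C => // n v; apply: (@le_trans _ _ (s n)%:E); last first.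
  by rewrite lee_fin (le_trans (HC n))// expr0 divr1.
elim: n v => [|n IHn] v.
  by under eq_integral do rewrite /W expr0 mul1r expr1n; rewrite [leLHS]Ex_cst.
under eq_integral do rewrite WS.
exact: (Ex_sqr_step (fun i => @fm_W n (rcons v i)) (s0 n)
  (fun i => Ex_W n (rcons v i)) (fun i => IHn (rcons v i))).
Qed.

Let integrable_q n v : P.-integrable setT (EFin \o q n v).
Proof. by have [C _ HC] := Ex_q2; exact: sqr_integrable (HC n v). Qed.

Let integrable_W n v : P.-integrable setT (EFin \o W n v).
Proof. by have [C _ HC] := Ex_W2; exact: sqr_integrable (HC n v). Qed.

Let Ex_sub f g (c1 c2 c : R) : P.-integrable setT (EFin \o f) ->
  P.-integrable setT (EFin \o g) -> \Ex_P f = c1%:E -> \Ex_P g = c2%:E ->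
  \Ex_P (fun w => f w + c * g w) = (c1 + c * c2)%:E.
Proof.
move=> fi gi f1 g2; rewrite Ex_addi//; last exact: integrable_scale.
by rewrite Ex_scalei// f1 g2 -EFinM -EFinD.
Qed.

(** Martingale increment, written in the form f + c g of [Ex_sub]. *)
Let dW n v w := W n.+1 v w + (-1) * W n v w.

(** Increments inherit the linear recursion of [W] and are centred, so each generation multiplies
    the bound by exactly [p]. *)
Let Ex_dW2 : exists2 K, 0 <= K &
  forall n v, (\Ex_P (fun w => dW n v w ^+ 2) <= (K * p ^+ n)%:E)%E.
Proof.
have [C C0 HC] := Ex_W2; exists (2 * C + 2 * C); first by rewrite addr_ge0// mulr_ge0.
have fm_dW n v : fm (subtree v) (dW n v).
  by apply: measurable_funD; [|apply: fm_scale]; exact: fm_W.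
elim=> [|n IHn] v.
  rewrite expr0 mulr1.
  apply: (@le_trans _ _ (\Ex_P (fun w => 2 * W 1 v w ^+ 2 + 2 * W 0 v w ^+ 2))).
    apply: Ex_le => [||w|w].
    - by apply: measurable_funX; exact: fm_measurable (@fm_dW 0 v).
    - by apply: measurable_funD; apply: measurable_funM => //; exact: measurable_funX.
    - exact: sqr_ge0.
    - by have := sqr_ge0 (W 1 v w + W 0 v w); rewrite /dW !sqrrD; lra.
  rewrite Ex_add//; last 4 first.
  - by apply: measurable_funM => //; exact: measurable_funX.
  - by apply: measurable_funM => //; exact: measurable_funX.
  - by move=> w; rewrite mulr_ge0// sqr_ge0.
  - by move=> w; rewrite mulr_ge0// sqr_ge0.
  rewrite !Ex_scale//; try (by move=> w; exact: sqr_ge0); try exact: measurable_funX.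
  by rewrite [leRHS]EFinD leeD// [leRHS]EFinM lee_wpmul2l ?HC.
have dWS w : dW n.+1 v w = p * \sum_(i < N v w) dW n (rcons v i) w.
  rewrite /dW (WS n.+1 v w) (WS n v w) big_split/= mulrDr; congr (_ + _).
  by rewrite mulrCA [in LHS]mulr_sumr.
under eq_integral do rewrite dWS.
have K0 : 0 <= (2 * C + 2 * C) * p ^+ n.
  by rewrite mulr_ge0 ?addr_ge0 ?mulr_ge0// exprn_ge0// ltW.
have dW0 i : \Ex_P (dW n (rcons v i)) = 0%:E.
  rewrite (Ex_sub (-1) (integrable_W n.+1 (rcons v i)) (integrable_W n (rcons v i))
    (Ex_W _ _) (Ex_W _ _)).
  by congr EFin; ring.
apply: (le_trans (Ex_sqr_step (fun i => @fm_dW n (rcons v i)) K0 dW0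
  (fun i => IHn (rcons v i)))).
by rewrite lee_fin [p ^+ n.+1]exprS expr0n mulr0 addr0 mulrCA.
Qed.

Let D n v w := q n v w + (- annealed n) * W n v w.

(** A rate strictly between [p] and 1: the slack pays for Young's inequality in [Ex_D2] and for the
    geometric weights in [W_cvg]. *)
Let t : R := (1 + p) / 2.
Let t_itv : p < t < 1. Proof. by apply/andP; split; rewrite /t; have := p1; lra. Qed.

Let remainder n v w := p * \sum_(i < N v w) q n (rcons v i) w - q n.+1 v w.

Let DS n v w : D n.+1 v w = p * \sum_(i < N v w) D n (rcons v i) w +
  ((annealed n - annealed n.+1) * W n.+1 v w - remainder n v w).
Proof.
rewrite /remainder /D big_split/= -(mulr_sumr _ _ (fun i : 'I__ => W n (rcons v i) w)).
by rewrite mulrDr [p * (- _ * _)]mulrCA -WS; ring.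
Qed.

Let fm_remainder n v : fm (subtree v) (remainder n v).
Proof.
apply: measurable_funB => //; last exact: (@fm_q n.+1 v).
pose G k w := p * \sum_(i < k) q n (rcons v i) w.
apply: (fm_count (G := G)) => k; apply: fm_below; apply: fm_scale.
exact: (fm_sum (F := fun i => q n (rcons v i)) (fun i => @fm_q n (rcons v i))).
Qed.

(** By [sqr_pair_sum_le] the square is at most k^2 times a sum over pairs of products of squares.
    Siblings being independent, each product has mean O(n^-2) squared, so second moments of [q]
    suffice; the k^2 pairs and the prefactor k^2 make up E Z^4. *)
Let Ex_remainder2 : exists2 C, 0 <= C &
  forall n v, (\Ex_P (fun w => remainder n v w ^+ 2) <= (C / n.+1%:R ^+ 4)%:E)%E.
Proof.
have [C C0 HC] := Ex_q2.
have m4 : 0 <= m 4 by apply/fine_ge0/Ex_ge0 => w; rewrite exprn_ge0.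
exists (m 4 * (p ^+ 2 * C) ^+ 2) => [|n v]; first by rewrite mulr_ge0 ?sqr_ge0//.
pose s := p ^+ 2 * (C / n.+1%:R ^+ 2).
have s0 : 0 <= s by rewrite mulr_ge0 ?sqr_ge0// divr_ge0// exprn_ge0.
pose F i w := (p * q n (rcons v i) w) ^+ 2.
have mF i : fm (subtree (rcons v i)) (F i).
  by apply: measurable_funX; apply: fm_scale; exact: fm_q.
have F0 i w : 0 <= F i w by exact: sqr_ge0.
have Fs i : (\Ex_P (F i) <= s%:E)%E.
  under eq_integral do rewrite /F exprMn.
  rewrite (@Ex_scale _ _ _ P (fun w => q n (rcons v i) w ^+ 2))//; last 3 first.
  - by apply: measurable_funX; exact: mq.
  - by move=> w; exact: sqr_ge0.
  - exact: sqr_ge0.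
  by rewrite /s [leRHS]EFinM lee_wpmul2l ?HC// lee_fin sqr_ge0.
have mps k : fm (branches v k) (fun w => pair_sum (F ^~ w) k).
  exact: (fm_pair_sum (@mF)).
pose G k w := k%:R ^+ 2 * pair_sum (F ^~ w) k.
have mG k : fm (below v) (G k).
  by apply: fm_below; apply: fm_scale; exact: mps.
have G0 k w : 0 <= G k w by rewrite mulr_ge0 ?sqr_ge0// pair_sum_ge0.
pose g k : R := s ^+ 2 * k%:R ^+ 4.
have g0 k : 0 <= g k by rewrite mulr_ge0 ?sqr_ge0// exprn_ge0.
have Gg k : (\Ex_P (G k) <= (g k)%:E)%E.
  rewrite /G (@Ex_scale _ _ _ P (fun w => pair_sum (F ^~ w) k))//; last 2 first.
  - exact: (fm_measurable (@mps k)).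
  - by move=> w; exact: pair_sum_ge0.
  apply: (@le_trans _ _ ((k%:R ^+ 2)%:E * (k%:R ^+ 2 * s ^+ 2)%:E)%E).
    by rewrite lee_wpmul2l ?lee_fin ?sqr_ge0//; exact: (Ex_pair_sum_le ind (@mF)).
  by rewrite -EFinM lee_fin /g; lra.
have dom4 : dominated (fun k => k%:R ^+ 4) by exact: dominated_pow.
have := Ex_index_le ind mG G0 g0 Gg.
rewrite lawE//; last exact: dominatedZ.
rewrite meanZ// -/(m 4) => H.
apply: (@le_trans _ _ (\Ex_P (fun w => G (N v w) w))).
  apply: Ex_le => [||w|w].
  - by apply: measurable_funX; exact: (fm_measurable (@fm_remainder n v)).
  - exact: (fm_measurable (fm_count mG)).
  - exact: sqr_ge0.
  - have pq0 i : 0 <= p * q n (rcons v i) w by case/andP: (pq01 n (rcons v i) w).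
    apply: le_trans (sqr_pair_sum_le (N v w) pq0).
    have /andP[L U] := one_sub_prod_bounds (N v w) (fun i => pq01 n (rcons v i) w).
    move: L U; rewrite -mulr_sumr -qS => L U.
    rewrite lerXn2r ?nnegrE/remainder ?subr_ge0 ?pair_sum_ge0//.
    by move: L; lra.
apply: (le_trans H); rewrite lee_fin mulrC -mulrA ler_wpM2l//.
rewrite le_eqVlt; apply/orP; left; apply/eqP.
by rewrite /s; field; rewrite addrC natr1 pnatr_eq0.
Qed.

Let fm_D n v : fm (subtree v) (D n v).
Proof. by apply: measurable_funD; [|apply: fm_scale]; [exact: fm_q|exact: fm_W]. Qed.

Let Ex_D n v : \Ex_P (D n v) = 0%:E.
Proof.
rewrite (Ex_sub (- annealed n) (integrable_q n v) (integrable_W n v)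
  (Ex_q _ _) (Ex_W _ _)).
by rewrite mulr1 subrr.
Qed.

Let Ex_D2 : exists2 C, 0 <= C &
  forall n v, (\Ex_P (fun w => D n v w ^+ 2) <= (C / n.+1%:R ^+ 4)%:E)%E.
Proof.
have [Ca Ca0 HCa] := annealed_decay.
have [Cw Cw0 HCw] := Ex_W2.
have [Cr Cr0 HCr] := Ex_remainder2.
have /andP[pt t1] := t_itv.
have t0 : 0 < t by exact: lt_trans pt.
pose K := t / (t - p).
have K0 : 0 <= K by rewrite divr_ge0 ?subr_ge0// ltW.
pose ab := p ^+ 2 * phi2 / 2 + p ^+ 3 * m 3.
have ab0 : 0 <= ab by rewrite addr_ge0// ltW.
(* [K] times the n^-4 coefficients of the two source terms: a_n - a_{n+1} is at most [ab] a_n^2,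
   hence at most [ab * Ca ^+ 2] over (n+1)^2, and both factors 2 come from (x - y)^2 <= 2 x^2 + 2
   y^2. *)
pose A := K * (2 * (ab * Ca ^+ 2) ^+ 2 * Cw + 2 * Cr).
have A0 : 0 <= A.
  by rewrite mulr_ge0// addr_ge0 ?mulr_ge0// ?sqr_ge0 // mulr_ge0// sqr_ge0.
(* It starts at 0 because q_0 = a_0 = W_0 = 1, so D_0 vanishes. *)
pose s := fix s n := if n is k.+1 then t * s k + A / k.+1%:R ^+ 4 else 0 : R.
have s0 n : 0 <= s n.
  by elim: n => //= n IHn; rewrite addr_ge0 ?divr_ge0 ?exprn_ge0// mulr_ge0// ltW.
have [|||C C0 HC] := @contraction_decay R s t A 4 s0.
- by rewrite t1 ltW.
- by [].
- by [].
exists C => // n v; apply: (@le_trans _ _ (s n)%:E); last by rewrite lee_fin HC.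
elim: n v => [|n IHn] v.
  rewrite (eq_integral (fun=> 0%:E)) ?Ex_cst// => w _.
  by rewrite /D /W expr0 /= mul1r mulr1 subrr expr0n.
have step := Ex_sqr_step (fun i => @fm_D n (rcons v i)) (s0 n)
  (fun i => Ex_D n (rcons v i)) (fun i => IHn (rcons v i)).
pose S w := p * \sum_(i < N v w) D n (rcons v i) w.
have mS : measurable_fun setT S.
  pose G k w := p * \sum_(i < k) D n (rcons v i) w.
  apply: (fm_measurable (fm_count (G := G) _)) => k; apply: fm_below; apply: fm_scale.
  exact: (fm_sum (F := fun i => D n (rcons v i)) (fun i => @fm_D n (rcons v i))).
pose delta := annealed n - annealed n.+1.
have mr : measurable_fun setT (remainder n v) := fm_measurable (@fm_remainder n v).
have mD : measurable_fun setT (D n.+1 v) := fm_measurable (@fm_D n.+1 v).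
have mW2 : measurable_fun setT (fun w => W n.+1 v w ^+ 2).
  by apply: measurable_funX; exact: mW.
have mr2 : measurable_fun setT (fun w => remainder n v w ^+ 2) by exact: measurable_funX.
have mS2 : measurable_fun setT (fun w => S w ^+ 2) by exact: measurable_funX.
have mZl (c : R) (f : T -> R) : measurable_fun setT f ->
    measurable_fun setT (fun w => c * f w).
  by move=> mf; apply: measurable_funM.
have tp0 : 0 <= t / p by rewrite divr_ge0// ltW.
have Kd0 : 0 <= K * 2 * delta ^+ 2 by rewrite mulr_ge0 ?sqr_ge0// mulr_ge0.
have K20 : 0 <= K * 2 by rewrite mulr_ge0.
(* Young's inequality [(x + y)^2 <= (t/p) x^2 + t/(t-p) y^2] leaves the
   contraction factor [(t/p) p = t < 1]. *)
have young (x y : R) : (x + y) ^+ 2 <= t / p * x ^+ 2 + K * y ^+ 2.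
  have -> : t / p * x ^+ 2 + K * y ^+ 2 = (x + y) ^+ 2 +
      ((t - p) * x - p * y) ^+ 2 / (p * (t - p)).
    by rewrite /K; field; rewrite subr_eq0 !gt_eqF.
  by rewrite lerDl divr_ge0 ?sqr_ge0// mulr_ge0 ?subr_ge0// ltW.
have sqrB (x y : R) : (x - y) ^+ 2 <= 2 * x ^+ 2 + 2 * y ^+ 2.
  by have := sqr_ge0 (x + y); rewrite sqrrD sqrrB; lra.
apply: (@le_trans _ _ (\Ex_P (fun w => t / p * S w ^+ 2 +
    (K * 2 * delta ^+ 2 * W n.+1 v w ^+ 2 + K * 2 * remainder n v w ^+ 2)))).
  apply: Ex_le => [||w|w].
  - exact: measurable_funX.
  - apply: measurable_funD; first exact: mZl.
    by apply: measurable_funD; exact: mZl.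
  - exact: sqr_ge0.
  - rewrite DS -/(S w) -/delta; apply: (le_trans (young _ _)); rewrite lerD2l.
    apply: (@le_trans _ _ (K * (2 * (delta * W n.+1 v w) ^+ 2 + 2 * remainder n v w ^+ 2))).
      by rewrite ler_wpM2l.
    by rewrite exprMn le_eqVlt; apply/orP; left; apply/eqP; ring.
rewrite Ex_add; last 4 first.
- exact: mZl.
- by apply: measurable_funD; exact: mZl.
- by move=> w; apply: mulr_ge0 => //; exact: sqr_ge0.
- by move=> w; apply: addr_ge0; apply: mulr_ge0 => //; exact: sqr_ge0.
rewrite Ex_add; last 4 first.
- exact: mZl.
- exact: mZl.
- by move=> w; apply: mulr_ge0 => //; exact: sqr_ge0.
- by move=> w; apply: mulr_ge0 => //; exact: sqr_ge0.
have sq0 (f : T -> R) w : 0 <= f w ^+ 2 by exact: sqr_ge0.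
rewrite (@Ex_scale _ _ _ P (fun w => S w ^+ 2))//.
rewrite (@Ex_scale _ _ _ P (fun w => W n.+1 v w ^+ 2))//.
rewrite (@Ex_scale _ _ _ P (fun w => remainder n v w ^+ 2))//.
have le1 : ((t / p)%:E * \Ex_P (fun w => S w ^+ 2) <= (t * s n)%:E)%E.
  apply: (@le_trans _ _ ((t / p)%:E * (p * s n)%:E)%E).
    rewrite lee_wpmul2l//; apply: (le_trans step).
    by rewrite expr0n mulr0 addr0.
  by rewrite -EFinM lee_fin mulrA divfK// gt_eqF.
have le2 : ((K * 2 * delta ^+ 2)%:E * \Ex_P (fun w => W n.+1 v w ^+ 2) <=
    (K * 2 * ((ab * Ca ^+ 2) / n.+1%:R ^+ 2) ^+ 2 * Cw)%:E)%E.
  rewrite [leRHS]EFinM lee_pmul ?lee_fin ?Ex_ge0 ?HCw//.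
  rewrite ler_wpM2l// lerXn2r ?nnegrE//.
  - by case/andP: (annealed_decrement n).
  - by rewrite divr_ge0 ?exprn_ge0// mulr_ge0// exprn_ge0.
  - case/andP: (annealed_decrement n) => _ H; apply: (le_trans H).
    rewrite -/ab -mulrA ler_wpM2l// -expr_div_n lerXn2r ?nnegrE ?divr_ge0//.
    exact: ltW.
have le3 : ((K * 2)%:E * \Ex_P (fun w => remainder n v w ^+ 2) <=
    (K * 2 * (Cr / n.+1%:R ^+ 4))%:E)%E.
  by rewrite [leRHS]EFinM lee_wpmul2l// HCr.
apply: (le_trans (leeD le1 (leeD le2 le3))).
rewrite -!EFinD lee_fin /= lerD2l le_eqVlt; apply/orP; left; apply/eqP.
by rewrite /A; field; rewrite addrC natr1 pnatr_eq0.
Qed.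

(** * Almost sure convergence *)

Let W_cvg : {ae P, forall w, cvgn (fun n => W n [::] w)}.
Proof.
have [K K0 HK] := Ex_dW2.
have /andP[pt t1] := t_itv; have t0 : 0 < t by exact: lt_trans pt.
have r01 : 0 <= p / t < 1.
  by rewrite divr_ge0 ?ltW//= ltr_pdivrMr// mul1r.
have amgm (a x : R) : 0 < a -> x <= a / 2 + a^-1 / 2 * x ^+ 2.
  move=> a0; have -> : a / 2 + a^-1 / 2 * x ^+ 2 = x + (a - x) ^+ 2 / (2 * a).
    by field; rewrite gt_eqF.
  by rewrite lerDl divr_ge0 ?sqr_ge0// mulr_ge0// ltW.
(* The inequality x <= a/2 + x^2/(2a) with a = t^n passes from the second moment K p^n of an
   increment to its absolute first moment; both parts are geometric since p < t < 1. *)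
pose u n := t ^+ n / 2 + K / 2 * (p / t) ^+ n.
apply: (ae_cvg_increments (f := fun n => W n [::]) (u := u)
    (B := (1 - t)^-1 / 2 + K / 2 * (1 - p / t)^-1)) => [n|n|n]; first exact: mW.
- have tn : 0 < t ^+ n by rewrite exprn_gt0.
  have mdW : measurable_fun setT (dW n [::]).
    apply: measurable_funD; first exact: mW.
    by apply: measurable_funM => //; exact: mW.
  have mdW2 : measurable_fun setT (fun w => (t ^+ n)^-1 / 2 * dW n [::] w ^+ 2).
    by apply: measurable_funM => //; exact: measurable_funX.
  have c0 : 0 <= (t ^+ n)^-1 / 2 by rewrite divr_ge0// invr_ge0 ltW.
  apply: (@le_trans _ _ (\Ex_P (fun w => t ^+ n / 2 + (t ^+ n)^-1 / 2 * dW n [::] w ^+ 2))).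
    apply: Ex_le => [||//|w].
    + by apply: measurableT_comp => //; apply: measurable_funB; exact: mW.
    + exact: measurable_funD.
    + have -> : W n.+1 [::] w - W n [::] w = dW n [::] w by rewrite /dW mulN1r.
      by rewrite -(real_normK (num_real (dW n [::] w))); exact: amgm.
  rewrite Ex_add//; last 2 first.
  + by move=> w; rewrite divr_ge0// ltW.
  + by move=> w; apply: mulr_ge0 => //; exact: sqr_ge0.
  rewrite Ex_cst (@Ex_scale _ _ _ P (fun w => dW n [::] w ^+ 2))//; last 2 first.
  + exact: measurable_funX.
  + by move=> w; exact: sqr_ge0.
  rewrite [leRHS]EFinD leeD2l//.
  apply: (@le_trans _ _ (((t ^+ n)^-1 / 2)%:E * (K * p ^+ n)%:E)%E).
    by rewrite lee_wpmul2l.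
  rewrite -EFinM lee_fin (expr_div_n p t n) le_eqVlt; apply/orP; left; apply/eqP.
  have n0 : t ^+ n != 0 by rewrite gt_eqF.
  by move: (t ^+ n) (p ^+ n) n0 => a b a0; field.
- rewrite /u big_split/= -mulr_suml -mulr_sumr lerD//.
    by rewrite ler_wpM2r// sum_geometric_le// t1 ltW.
  by rewrite ler_wpM2l ?divr_ge0// sum_geometric_le.
Qed.

Let nD_cvg : {ae P, forall w, (fun n => n%:R * D n [::] w) @ \oo --> (0 : R)}.
Proof.
have [C C0 HC] := Ex_D2.
apply: (ae_cvg_to0 (f := fun n w => n%:R * D n [::] w)
    (u := fun n => C * (n.+1%:R ^+ 2)^-1) (B := C * 2)) => n.
- by apply: measurable_funM => //; exact: fm_measurable (@fm_D n [::]).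
- have mD2 : measurable_fun setT (fun w => D n [::] w ^+ 2).
    by apply: measurable_funX; exact: fm_measurable (@fm_D n [::]).
  under eq_integral do rewrite exprMn.
  rewrite (@Ex_scale _ _ _ P (fun w => D n [::] w ^+ 2))//; last first.
    by move=> w; exact: sqr_ge0.
  apply: (@le_trans _ _ ((n.+1%:R ^+ 2)%:E * (C / n.+1%:R ^+ 4)%:E)%E).
    rewrite lee_pmul ?HC ?lee_fin ?sqr_ge0//.
      by apply: Ex_ge0 => w; exact: sqr_ge0.
    by rewrite lerXn2r ?nnegrE// ler_nat.
  rewrite -EFinM lee_fin le_eqVlt; apply/orP; left; apply/eqP.
  by field; rewrite addrC natr1 pnatr_eq0.
- by rewrite -mulr_sumr ler_wpM2l// sum_inv_sqr_le.
Qed.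

(** Split n q_n = n D_n + (n a_n) W_n. The constant is the inverse of the quadratic coefficient p^2
    phi''(1)/2 of the annealed recursion, and [W_cvg] makes [limn] a genuine limit. *)
Lemma galton_watson_survival :
  {ae P, forall w, (fun n : nat => n%:R * surv mu^-1 (children ^~ w) n [::]) @ \oo -->
     limn (normalized_size mu (children ^~ w)) * (2 / (mu^-1 ^+ 2 * phi2))}.
Proof.
apply: filterS2 W_cvg nD_cvg => w Ww Dw.
have -> : normalized_size mu (children ^~ w) = fun n => W n [::] w.
  apply/funext => n; rewrite /normalized_size /W size_generation.
  by rewrite mulrC exprVn.
have -> : (fun n : nat => n%:R * surv mu^-1 (children ^~ w) n [::]) =
    (fun n => n%:R * D n [::] w + (n%:R * annealed n) * W n [::] w).
  by apply/funext => n; rewrite /D -[surv _ _ _ _]/(q n [::] w); ring.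
rewrite -[X in _ --> X]add0r; apply: cvgD => //.
rewrite mulrC; apply: cvgM => //.
rewrite (_ : 2 / _ = (p ^+ 2 * phi2 / 2)^-1); first exact: annealed_cvg.
by rewrite invf_div.
Qed.

End GaltonWatson.

Theorem theorem3p3 (R : realType)
    (d0 d d' : measure_display)
    (T0 : measurableType d0) (T : measurableType d) (T' : measurableType d')
    (P0 : probability T0 R) (P : probability T R) (Q : probability T' R)
    (Z : {RV P0 >-> nat})
    (children : seq nat -> {RV P >-> nat})
    (open : seq nat -> {RV Q >-> bool}) :
  let mu : R := fine (progeny_mean Z) in
  let pc : R := mu^-1 in
  let lambda : R := 2 / (pc ^+ 2 * fine (pgf_deriv2_at1 Z)) in
  let tree (w : T) : seq nat -> nat := fun v => children v w in
  let W (w : T) : R := limn (normalized_size mu (tree w)) in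
  (forall w, (1 <= Z w)%N) ->
  (1 < progeny_mean Z)%E ->
  (progeny_moment4 Z < +oo)%E ->
  galton_watson Z children ->
  bernoulli_percolation pc open ->
  {ae P, forall w,
    (fun n : nat => n%:R * quenched_survival open (tree w) n) @ \oo
      --> W w * lambda}.
Proof.
move=> mu pc lambda tree W Z1 Z_mean Z4 gw perc.
apply: filterS (galton_watson_survival Z1 Z_mean Z4 gw) => w.
rewrite (_ : (fun n : nat => n%:R * surv _ _ n [::]) =
  (fun n : nat => n%:R * quenched_survival open (tree w) n))//.
by apply/funext => n; rewrite (quenched_survivalE perc).
Qed.
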